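(* The function $b\mapsto 1-Q_\nu(a,b)$ is log-concave on $[0,\infty)$ if either (i) $\nu\ge 1/2$ and $0\le a\le 1$, or (ii) $\nu\ge\nu_0$ and $a\ge 0$.
   Context: For $\mu>-1$ and $t>0$, the modified Bessel function of the first kind is $I_\mu(t)=\sum_{k=0}^\infty \frac{(t/2)^{2k+\mu}}{k!\,\Gamma(\mu+k+1)}$. For $\nu>0$, $a,b\ge 0$, the generalized Marcum Q function is $$Q_\nu(a,b)=\int_b^\infty \frac{t^\nu}{a^{\nu-1}}\exp\left(-\frac{t^2+a^2}{2}\right)I_{\nu-1}(at)\,dt,$$ where $Q_\nu(0,b)$ is defined by taking the limit $a\downarrow 0$; explicitly $Q_\nu(0,b)=\int_b^\infty \frac{t^{2\nu-1}}{2^{\nu-1}\Gamma(\nu)}e^{-t^2/2}\,dt$. The constant $\nu_0\approx 0.78449776$ is the unique solution of the equation $\frac{I_\nu(\sqrt{5-2\nu})}{I_{\nu-1}(\sqrt{5-2\nu})}=\frac{3-2\nu}{\sqrt{5-2\nu}}$ in the interval $\nu\in(1/2,3/2)$. A nonnegative function $g$ on an interval $J$ is log-concave if $g(\lambda x+(1-\lambda)y)\ge g(x)^\lambda g(y)^{1-\lambda}$ for all $x,y\in J$, $\lambda\in(0,1)$. *)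

(* Defs.v *)
From mathcomp Require Export all_boot all_order all_algebra.
From mathcomp Require Export all_classical all_reals all_analysis.
Export Order.TTheory GRing.Theory Num.Theory.
Export numFieldNormedType.Exports.

Set Implicit Arguments.
Unset Strict Implicit.
Unset Printing Implicit Defensive.

Local Open Scope classical_set_scope.
Local Open Scope ring_scope.

(* Euler's integral; only used for x > 0, where it converges. *)
Definition Gamma (R : realType) (x : R) : R :=
  \int[lebesgue_measure]_(t in `]0, +oo[) (t `^ (x - 1) * expR (- t)).

(* I_mu(t), meant for mu > -1 and t > 0. *)
Definition besselI (R : realType) (mu t : R) : R :=
  limn (series (fun k : nat =>
    (t / 2) `^ (2 * k%:R + mu) / (k`!%:R * Gamma (mu + k%:R + 1)))).

Definition marcum_density (R : realType) (nu a t : R) : R :=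
  t `^ nu / a `^ (nu - 1) * expR (- ((t ^+ 2 + a ^+ 2) / 2))
    * besselI (nu - 1) (a * t).

(* The integral formula is degenerate at a = 0, where Q is the limit a -> 0+. *)
Definition marcumQ_pos (R : realType) (nu a b : R) : R :=
  \int[lebesgue_measure]_(t in `[b, +oo[) marcum_density nu a t.

Definition marcumQ (R : realType) (nu a b : R) : R :=
  if a == 0 then lim (marcumQ_pos nu a' b @[a' --> 0^'+])
  else marcumQ_pos nu a b.

Definition nu0_equation (R : realType) (nu : R) : Prop :=
  let s := Num.sqrt (5 - 2 * nu) in
  besselI nu s / besselI (nu - 1) s = (3 - 2 * nu) / s.

(* Numerically, nu0 = 0.78449776... *)
Definition is_nu0 (R : realType) (nu0 : R) : Prop :=
  unique (fun nu : R => 1 / 2 < nu < 3 / 2 /\ nu0_equation nu) nu0.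

(* Note that 0 `^ l = 0 for 0 < l, so zeros of g are handled as usual. *)
Definition log_concave_on (R : realType) (J : interval R) (g : R -> R) : Prop :=
  (forall x, x \in J -> 0 <= g x) /\
  (forall x y l, x \in J -> y \in J -> 0 < l < 1 ->
     g x `^ l * g y `^ (1 - l) <= g (l * x + (1 - l) * y)).

(* Main.v *)
Require Import Defs.
From mathcomp Require Import ring lra measurable_realfun.

(** The function 1 - Q_nu(a, b) is the distribution function of a noncentral chi
    law. Write m = 2 nu - 1 and F(u) = 0F1(; nu; u), the series with terms
    u^k / (k! nu (nu+1) ... (nu+k-1)). The density is
      f(t) = t^m exp(-(t^2 + a^2)/2) F(a^2 t^2 / 4) / (2^(nu-1) Gamma(nu)).
    Expanding F exhibits f as a Poisson mixture of central chi densities; hence f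
    has mass 1 (integral_chi_density) and 1 - Q_nu(a, b) is the integral of f over
    [0, b], also for a = 0 where Q is a limit (marcumQ_chi_cdf). The primitive from
    0 of a log-concave function is log-concave (log_concave_on_primitive), so it is
    enough that f be log-concave.

    Let y = 2 u F'/F, which is x I_nu(x) / I_(nu-1)(x) at u = x^2/4. It solves the
    Riccati equation 2 u y' = 4 u - (m-1) y - y^2 (bessel_quot_ode), and this
    turns (log f)'' <= 0 at t into
      W(u) + t^2 >= 0,  W = y^2 + m y + m - 4 u,  u = a^2 t^2 / 4.
    If nu >= 1/2 and a <= 1, then 4 u <= t^2 and the inequality is immediate.

    For unrestricted a one needs W >= 0 everywhere. The function
    V = u^(nu-3/2) F^2 W satisfies u V' = (m/2) u^(nu-3/2) F^2 (y - (3 - 2 nu))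
    (amos_numer_weight), and y is nondecreasing by a Turan-type inequality
    (turan_hyp0F1). If nu >= 3/2, then V increases from nonnegative values. If
    nu < 3/2, then V is minimal at the point c with y(c) = 3 - 2 nu, where
    W(c) = 5 - 2 nu - 4 c. This is nonnegative iff c <= (5 - 2 nu)/4, that is, iff
    y >= 3 - 2 nu at u = (5 - 2 nu)/4, i.e. at x = sqrt(5 - 2 nu)
    (amos_gap_ge0_critical). Equality in this last condition is the equation that
    defines nu0. The condition holds strictly at nu = 3/2, so by continuity in nu
    and uniqueness of nu0 it holds on the whole of [nu0, 3/2) (nu0_critical). *)

Set Implicit Arguments.
Unset Strict Implicit.
Unset Printing Implicit Defensive.
Local Open Scope classical_set_scope.
Local Open Scope ring_scope.

(** * Calculus on the half-line, and primitives of log-concave functions *)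

(** The differentiation rules are stated for explicit lambda terms, and the
    direction is fixed to 1, so that the derivative of a compound expression is
    assembled as one proof term and compared with the intended value by ring
    or field. *)
Lemma deriveD1 (R : realType) (f g : R -> R) (x df dg : R) :
  is_derive x 1 f df -> is_derive x 1 g dg ->
  is_derive x 1 (fun t => f t + g t) (df + dg).
Proof. by move=> hf hg; exact: is_deriveD. Qed.

Lemma deriveN1 (R : realType) (f : R -> R) (x df : R) :
  is_derive x 1 f df -> is_derive x 1 (fun t => - f t) (- df).
Proof. by move=> hf; exact: is_deriveN. Qed.

Lemma deriveM1 (R : realType) (f g : R -> R) (x df dg : R) :
  is_derive x 1 f df -> is_derive x 1 g dg ->
  is_derive x 1 (fun t => f t * g t) (df * g x + f x * dg).
Proof.
move=> hf hg; apply: is_derive_eq (is_deriveM hf hg) _.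
by rewrite /GRing.scale/=; ring.
Qed.

Lemma deriveC1 (R : realType) (c x : R) : is_derive x 1 (fun=> c) 0.
Proof. exact: is_derive_cst. Qed.

Lemma deriveI1 (R : realType) (x : R) : is_derive x 1 (fun t => t) 1.
Proof. exact: is_derive_id. Qed.

Lemma derive_shift (R : realType) (c x : R) : is_derive x 1 (fun t => t + c) 1.
Proof. by have := deriveD1 (deriveI1 x) (deriveC1 c x); rewrite addr0. Qed.

Lemma derive_comp1 (R : realType) (f g : R -> R) (x df dg : R) :
  is_derive (g x) 1 f df -> is_derive x 1 g dg ->
  is_derive x 1 (fun t => f (g t)) (df * dg).
Proof. by move=> hf hg; exact: is_derive1_comp. Qed.

Lemma deriveV1 (R : realType) (f : R -> R) (x df : R) :
  f x != 0 -> is_derive x 1 f df ->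
  is_derive x 1 (fun t => (f t)^-1) (- df / f x ^+ 2).
Proof.
move=> fx hf; apply: is_derive_eq (is_deriveV fx hf) _.
by rewrite /GRing.scale/= mulNr mulrC mulNr.
Qed.

Lemma derive_exp1 (R : realType) (f : R -> R) (x df : R) :
  is_derive x 1 f df -> is_derive x 1 (fun t => expR (f t)) (expR (f x) * df).
Proof. by move=> hf; apply: derive_comp1 => //; exact: is_derive_exp. Qed.

Lemma is_derive_continuous (R : realType) (f : R -> R) (x df : R) :
  is_derive x 1 f df -> {for x, continuous f}.
Proof.
by move=> hf; apply/differentiable_continuous/derivable1_diffP; exact: ex_derive.
Qed.

Lemma nondecreasing_cc (R : realType) (f df : R -> R) (a b : R) :
  a <= b -> {within `[a, b], continuous f} ->
  (forall x : R, a < x < b -> is_derive x 1 f (df x)) ->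
  (forall x : R, a < x < b -> 0 <= df x) -> f a <= f b.
Proof.
move=> ab cf hf df0; apply: (@ger0_derive1_le_cc _ f a b) => //.
- by move=> x /[!in_itv]/= /hf hx; exact: ex_derive.
- move=> x /[!in_itv]/= xab; have hx := hf _ xab.
  by rewrite derive1E derive_val; exact: df0.
- by rewrite in_itv/= lexx.
- by rewrite in_itv/= lexx andbT.
Qed.

Lemma nondecreasing_derive (R : realType) (f df : R -> R) (a b : R) :
  a <= b -> (forall x : R, a <= x <= b -> is_derive x 1 f (df x)) ->
  (forall x : R, a <= x <= b -> 0 <= df x) -> f a <= f b.
Proof.
move=> ab hf df0; apply: (@nondecreasing_cc _ f df) => //.
- apply: derivable_within_continuous => x /[!in_itv]/= /hf hx; exact: ex_derive.
- by move=> x /andP[ax xb]; apply: hf; rewrite !ltW.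
- by move=> x /andP[ax xb]; apply: df0; rewrite !ltW.
Qed.

(** The power of x acts as an integrating factor: multiplied by x^(1-e), the
    derivative of x^e N is e N + x N', which for Euler-type equations is free of
    fractional powers. *)
Lemma powR_weight_nondecreasing (R : realType) (e : R) (N dN : R -> R) (a b : R) :
  0 < a -> a <= b ->
  (forall x : R, a <= x <= b -> is_derive x 1 N (dN x)) ->
  (forall x : R, a <= x <= b -> 0 <= e * N x + x * dN x) ->
  a `^ e * N a <= b `^ e * N b.
Proof.
move=> a0 ab hN h.
apply: (@nondecreasing_derive _ (fun x => x `^ e * N x)
  (fun x => e * x `^ (e - 1) * N x + x `^ e * dN x)) => // x xab.
  have x0 : 0 < x by case/andP: xab => + _; exact: lt_le_trans.
  by apply: deriveM1; [exact: is_derive1_powR|exact: hN].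
have x0 : 0 < x by case/andP: xab => + _; exact: lt_le_trans.
have -> : x `^ e = x `^ (e - 1) * x.
  have := @powRD _ x (e - 1) 1; rewrite (gt_eqF x0) implybT subrK => ->//.
  by rewrite powRr1// ltW.
rewrite (_ : _ + _ = x `^ (e - 1) * (e * N x + x * dN x)); last by ring.
by rewrite mulr_ge0 ?powR_ge0 ?h.
Qed.

(** Log-concavity of f is used only in the form that b |-> f(b) / f(b+d) is
    nondecreasing. Integrating the inequality in t shows that r = f / F is
    nonincreasing; r is the logarithmic derivative of F, so log F lies below its
    tangent at every point, and averaging the two tangent inequalities at the
    convex combination z gives the claim. *)
Lemma log_concave_on_primitive (R : realType) (f F : R -> R) :
  F 0 = 0 -> (forall b : R, 0 < b -> {within `[0, b], continuous F}) ->
  (forall x : R, 0 < x -> is_derive x 1 F (f x)) ->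
  (forall x : R, 0 < x -> 0 < f x) ->
  (forall t b d : R, 0 < t -> t <= b -> 0 <= d ->
     f t * f (b + d) <= f b * f (t + d)) ->
  log_concave_on `[0, +oo[ F.
Proof.
move=> F0 cF dF f0 lcf.
have Fge0 x : 0 <= x -> 0 <= F x.
  rewrite le_eqVlt => /predU1P[<-|x0]; first by rewrite F0.
  rewrite -F0; apply: (@nondecreasing_cc _ F f) (ltW x0) (cF _ x0) _ _.
    by move=> y /andP[y0 _]; exact: dF.
  by move=> y /andP[y0 _]; exact/ltW/f0.
(* f / F is nonincreasing *)
have cross b d : 0 < b -> 0 <= d -> F b * f (b + d) <= F (b + d) * f b.
  move=> b0 d0; pose H t := f b * (F (t + d) - F d) - f (b + d) * F t.
  have dFd (t : R) : 0 < t -> is_derive t 1 (fun t => F (t + d)) (f (t + d)).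
    move=> t0; rewrite -[f _]mulr1; apply: derive_comp1.
      by apply: dF; rewrite ltr_wpDr.
    exact: derive_shift.
  have : H 0 <= H b.
    pose dH t := f b * f (t + d) - f (b + d) * f t.
    apply: (@nondecreasing_cc _ H dH) (ltW b0) _ _ _.
    - have cH : {within `[0, b], continuous (fun t => F (t + d))}.
        have [->|dn0] := eqVneq d 0.
          rewrite (_ : (fun t => F (t + 0)) = F); first exact: cF.
          by apply/funext => t; rewrite addr0.
        apply: derivable_within_continuous => t /[!in_itv]/= /andP[t0 _].
        suff h : is_derive t 1 (fun t => F (t + d)) (f (t + d)) by exact: ex_derive.
        rewrite -[f _]mulr1; apply: derive_comp1.
          by apply: dF; rewrite ltr_wpDl// lt_neqAle eq_sym dn0.
        exact: derive_shift.
      move=> x; apply: cvgB; apply: cvgM; try exact: cvg_cst.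
        by apply: cvgB; [exact: cH|exact: cvg_cst].
      exact: (cF _ b0).
    - move=> t /andP[t0 tb].
      rewrite (_ : dH t = (0 * (F (t + d) - F d) + f b * (f (t + d) + - 0)) -
                          (0 * F t + f (b + d) * f t)); last by rewrite /dH; ring.
      rewrite /H; apply: deriveD1.
        by apply: deriveM1; apply: deriveD1; exact: dFd.
      by apply: deriveN1; apply: deriveM1; exact: dF.
    - move=> t /andP[t0 tb]; rewrite /dH subr_ge0 mulrC.
      by apply: lcf => //; exact: ltW.
  rewrite /H F0 add0r subrr !mulr0 subrr subr_ge0 mulrC => /le_trans; apply.
  by rewrite mulrC ler_wpM2r ?(ltW (f0 _ _))// lerBlDr lerDl Fge0.
have Fgt0 x : 0 < x -> 0 < F x.
  move=> x0; rewrite lt_neqAle Fge0 ?(ltW x0)// andbT eq_sym.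
  apply/negP => /eqP Fx0.
  have x20 : 0 < x / 2 by lra.
  have [c cI] : exists2 c, c \in `]x / 2, x[ & F x - F (x / 2) = f c * (x - x / 2).
    apply: (@MVT _ F f (x / 2) x); first by lra.
      by move=> y /[!in_itv]/= /andP[y0 _]; apply: dF; exact: lt_trans y0.
    apply: derivable_within_continuous => y /[!in_itv]/= /andP[y0 _].
    have := dF y (lt_le_trans x20 y0) => hy; exact: ex_derive.
  move: cI => /[!in_itv]/= /andP[c0 cx]; rewrite Fx0 sub0r => E.
  have := Fge0 _ (ltW x20); have := f0 c (lt_trans x20 c0) => fc.
  have : 0 < f c * (x - x / 2) by rewrite mulr_gt0//; lra.
  by rewrite -E; lra.
(* log F lies below its tangent at z; K is F divided by the exponential of
   that tangent, and is maximal at z *)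
have tangent x z : 0 < x -> 0 < z ->
    F x <= F z * expR (f z / F z * (x - z)).
  move=> x0 z0; set r := f z / F z.
  pose K t := F t * expR (- (r * (t - z))).
  pose dK t := (f t - r * F t) * expR (- (r * (t - z))).
  have dKE (t : R) : 0 < t -> is_derive t 1 K (dK t).
    move=> t0; rewrite (_ : dK t = f t * expR (- (r * (t - z))) +
      F t * (expR (- (r * (t - z))) * - (0 * (t - z) + r * 1)));
      last by rewrite /dK; ring.
    apply: deriveM1; first exact: dF.
    by apply: derive_exp1; apply: deriveN1; apply: deriveM1; exact: derive_shift.
  suff : K x <= K z.
    rewrite /K subrr mulr0 oppr0 expR0 mulr1.
    by rewrite expRN ler_pdivrMr ?expR_gt0.
  have [xz|/ltW zx] := leP x z.
    apply: (@nondecreasing_derive _ K dK) => // t /andP[xt tz].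
      by apply: dKE; exact: lt_le_trans xt.
    have t0 : 0 < t by exact: lt_le_trans xt.
    rewrite mulr_ge0 ?expR_ge0// subr_ge0 /r mulrAC ler_pdivrMr ?Fgt0//.
    have := @cross t (z - t) t0; rewrite subr_ge0 => /(_ tz).
    by rewrite addrC subrK => h; rewrite mulrC (mulrC (f t)).
  rewrite -lerN2.
  apply: (@nondecreasing_derive _ (fun t => - K t) (fun t => - dK t)) => //.
    move=> t /andP[zt tx]; apply: deriveN1; apply: dKE; exact: lt_le_trans zt.
  move=> t /andP[zt tx]; rewrite /dK -mulNr opprB.
  rewrite mulr_ge0 ?expR_ge0// subr_ge0 /r mulrAC ler_pdivlMr ?Fgt0//.
  have := @cross z (t - z) z0; rewrite subr_ge0 => /(_ zt).
  by rewrite addrC subrK => h; rewrite mulrC (mulrC (f z)).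
split; first by move=> x /[!in_itv]/= /andP[x0 _]; exact: Fge0.
move=> x y l; rewrite !in_itv/= !andbT => x0 y0 /andP[l0 l1].
have l10 : 0 < 1 - l by rewrite subr_gt0.
have zge0 : 0 <= l * x + (1 - l) * y by rewrite addr_ge0// mulr_ge0// ltW.
move: x0; rewrite le_eqVlt => /predU1P[x0|x0].
  by rewrite -{1}x0 F0 powR0 ?gt_eqF// mul0r; exact: Fge0.
move: y0; rewrite le_eqVlt => /predU1P[y0|y0].
  by rewrite -{1}y0 F0 (@powR0 _ (1 - l)) ?gt_eqF// mulr0; exact: Fge0.
set z := l * x + _ in zge0 *.
have z0 : 0 < z by rewrite addr_gt0// mulr_gt0.
set r := f z / F z.
have Fl u p : 0 < u -> 0 < p -> F u `^ p <= F z `^ p * expR (r * (u - z) * p).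
  move=> u0 p0; rewrite expRM -powRM ?expR_ge0 ?Fge0 ?(ltW z0)//.
  apply: (ge0_ler_powR (ltW p0)); last exact: tangent.
    by rewrite nnegrE Fge0// ltW.
  by rewrite nnegrE mulr_ge0 ?expR_ge0// Fge0// ltW.
apply: le_trans (ler_pM (powR_ge0 _ _) (powR_ge0 _ _) (Fl _ _ x0 l0) (Fl _ _ y0 l10)) _.
rewrite mulrACA -expRD -powRD; last by rewrite (gt_eqF (Fgt0 _ z0)) implybT.
rewrite (_ : l + (1 - l) = 1); last by ring.
rewrite powRr1 ?Fge0 ?(ltW z0)//.
rewrite (_ : r * (x - z) * l + r * (y - z) * (1 - l) = 0) ?expR0 ?mulr1//.
by clearbody r; rewrite /z; ring.
Qed.

(** When the logarithmic derivative psi is nonincreasing, every ratio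
    f (s + d) / f s is nonincreasing in s. *)
Lemma log_concave_shift (R : realType) (f psi dpsi : R -> R) :
  (forall x : R, 0 < x -> 0 < f x) ->
  (forall x : R, 0 < x -> is_derive x 1 f (f x * psi x)) ->
  (forall x : R, 0 < x -> is_derive x 1 psi (dpsi x)) ->
  (forall x : R, 0 < x -> dpsi x <= 0) ->
  forall t b d : R, 0 < t -> t <= b -> 0 <= d ->
  f t * f (b + d) <= f b * f (t + d).
Proof.
move=> f0 df dp p0 t b d t0 tb d0.
have psi_le x y : 0 < x -> x <= y -> psi y <= psi x.
  move=> x0 xy; rewrite -lerN2.
  apply: (@nondecreasing_derive _ (fun x => - psi x)
    (fun x => - dpsi x)) => // z /andP[xz _].
    by apply: deriveN1; apply: dp; exact: lt_le_trans xz.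
  by rewrite oppr_ge0 p0// (lt_le_trans x0).
pose K s := f (s + d) * (f s)^-1.
have : - K t <= - K b.
  apply: (@nondecreasing_derive _ (fun s => - K s)
    (fun s => K s * (psi s - psi (s + d)))) => // s /andP[ts _].
    have s0 := lt_le_trans t0 ts; have sd0 : 0 < s + d by rewrite ltr_wpDr.
    have fs := lt0r_neq0 (f0 _ s0).
    have h := deriveN1 (deriveM1
      (@derive_comp1 _ f (fun s => s + d) s _ _ (df _ sd0) (derive_shift d s))
      (deriveV1 fs (df _ s0))).
    by apply: is_derive_eq h _; rewrite /K; field.
  have s0 := lt_le_trans t0 ts; have sd0 : 0 < s + d by rewrite ltr_wpDr.
  rewrite mulr_ge0//; first by rewrite divr_ge0// ltW// f0.
  by rewrite subr_ge0 psi_le// lerDl.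
rewrite lerN2 /K ler_pdivrMr ?f0 ?(lt_le_trans t0)// mulrAC ler_pdivlMr ?f0//.
by rewrite mulrC (mulrC (f b)).
Qed.

(** * The hypergeometric function 0F1(; nu; u) *)

(** Rising factorial; the Gamma quotients in the Bessel series reduce to it. *)
Definition poch (R : realType) (nu : R) (k : nat) : R :=
  \prod_(i < k) (nu + i%:R).

Definition hyp0F1_coef (R : realType) (nu : R) (k : nat) : R :=
  (k`!%:R * poch nu k)^-1.

(** Up to a power of t and a constant, I_(nu-1)(t) is this series at
    u = t^2 / 4. Splitting off the power removes the branch point at 0. *)
Definition hyp0F1 (R : realType) (nu u : R) : R := limn (pseries (hyp0F1_coef nu) u).

Lemma poch_gt0 (R : realType) (nu : R) k : 0 < nu -> 0 < poch nu k.
Proof. by move=> nu0; apply: prodr_gt0 => i _; rewrite ltr_pwDl. Qed.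

Lemma pochS (R : realType) (nu : R) k : poch nu k.+1 = poch nu k * (nu + k%:R).
Proof. by rewrite /poch big_ord_recr. Qed.

Lemma pochSl (R : realType) (nu : R) k : poch nu k.+1 = nu * poch (nu + 1) k.
Proof.
rewrite /poch big_ord_recl addr0; congr (_ * _); apply: eq_bigr => i _.
by rewrite /= /bump leq0n natrD addrA.
Qed.

Lemma hyp0F1_coef_ge0 (R : realType) (nu : R) k : 0 < nu -> 0 <= hyp0F1_coef nu k.
Proof. by move=> nu0; rewrite invr_ge0 mulr_ge0// ltW// poch_gt0. Qed.

Lemma le_poch (R : realType) (nu nu' : R) k :
  0 < nu -> nu <= nu' -> poch nu k <= poch nu' k.
Proof.
move=> nu0 nn'; apply: ler_prod => i _.
by rewrite lerD2r nn' andbT ltW// ltr_pwDl.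
Qed.

Lemma le_hyp0F1_coef (R : realType) (nu nu' : R) k :
  0 < nu -> nu <= nu' -> hyp0F1_coef nu' k <= hyp0F1_coef nu k.
Proof.
move=> nu0 nn'; have nu'0 := lt_le_trans nu0 nn'.
rewrite lef_pV2 ?posrE ?mulr_gt0 ?poch_gt0 ?ltr0n ?fact_gt0//.
by rewrite ler_wpM2l// le_poch.
Qed.

(** (nu' + i) / (nu + i) <= nu' / nu for every i. This lets a change of the
    parameter nu be absorbed in a dilation of the variable u. *)
Lemma le_poch_dilate (R : realType) (nu nu' : R) k :
  0 < nu -> nu <= nu' -> poch nu' k <= (nu' / nu) ^+ k * poch nu k.
Proof.
move=> nu0 nn'; have nu'0 := lt_le_trans nu0 nn'.
rewrite /poch -[X in _ ^+ X]card_ord -prodr_const -big_split/=.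
apply: ler_prod => i _; apply/andP; split; first by rewrite ltW// ltr_pwDl.
rewrite mulrDr divfK ?gt_eqF// lerD2l ler_peMl//.
by rewrite ler_pdivlMr// mul1r.
Qed.

Lemma le_hyp0F1_coef_exp (R : realType) (nu : R) k :
  0 < nu -> hyp0F1_coef nu k <= (1 + nu^-1) * (k`!%:R)^-1.
Proof.
move=> nu0; rewrite /hyp0F1_coef invfM mulrC ler_wpM2r ?invr_ge0//.
case: k => [|k]; first by rewrite /poch big_ord0 invr1 lerDl invr_ge0 ltW.
have p1 : 1 <= poch (nu + 1) k.
  elim: k => [|k ih]; first by rewrite /poch big_ord0.
  by rewrite pochS mulr_ege1// addrAC lerDr addr_ge0// ltW.
rewrite pochSl invfM; apply: (@le_trans _ _ (nu^-1)); last by rewrite lerDr.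
by rewrite ler_piMr ?invr_ge0 ?(ltW nu0)// invf_le1// (lt_le_trans ltr01).
Qed.

Lemma is_cvg_hyp0F1 (R : realType) (nu u : R) :
  0 < nu -> cvgn (pseries (hyp0F1_coef nu) u).
Proof.
move=> nu0; apply: normed_cvg.
apply: (@series_le_cvg _ _ (fun k => (1 + nu^-1) * exp_coeff `|u| k)) => [k|k|k|].
- exact: normr_ge0.
- by rewrite mulr_ge0// ?addr_ge0 ?invr_ge0 ?(ltW nu0)// exp_coeff_ge0.
- rewrite /= normrM normrX (ger0_norm (hyp0F1_coef_ge0 k nu0)) /exp_coeff/= mulrCA mulrC.
  by rewrite ler_wpM2l ?exprn_ge0// le_hyp0F1_coef_exp.
- rewrite (_ : series _ = (fun n => (1 + nu^-1) * series (exp_coeff `|u|) n)).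
    by apply: is_cvgMr; exact: is_cvg_series_exp_coeff.
  by apply/funext => n; rewrite /series/= mulr_sumr.
Qed.

Lemma hyp0F1_cvg (R : realType) (nu u : R) :
  0 < nu -> pseries (hyp0F1_coef nu) u @ \oo --> hyp0F1 nu u.
Proof. by move=> nu0; exact: is_cvg_hyp0F1. Qed.

Lemma pseries_diffs_hyp0F1_coef (R : realType) (nu : R) : 0 < nu ->
  pseries_diffs (hyp0F1_coef nu) = fun k => nu^-1 * hyp0F1_coef (nu + 1) k.
Proof.
move=> nu0; apply/funext => k; rewrite /pseries_diffs /hyp0F1_coef pochSl factS natrM.
have p0 : poch (nu + 1) k != 0 by rewrite gt_eqF// poch_gt0// ltr_wpDr.
have k0 : k`!%:R != 0 :> R by rewrite gt_eqF// ltr0n fact_gt0.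
have k1 : k.+1%:R != 0 :> R by rewrite pnatr_eq0.
have n0 : nu != 0 by rewrite gt_eqF.
move: k1 k0 p0; move: (k.+1%:R) (k`!%:R) (poch _ _) => x y z x0 y0 z0.
by field; rewrite x0 y0 z0 n0.
Qed.

Lemma pseriesZ (R : realType) (c : R) (f : nat -> R) (u : R) :
  pseries (fun k => c * f k) u = fun n => c * pseries f u n.
Proof.
apply/funext => n; rewrite /pseries/series/= mulr_sumr.
by apply: eq_bigr => k _; rewrite mulrA.
Qed.

Lemma pseries_diffs_cvg (R : realType) (nu u : R) : 0 < nu ->
  pseries (pseries_diffs (hyp0F1_coef nu)) u @ \oo --> nu^-1 * hyp0F1 (nu + 1) u.
Proof.
move=> nu0; rewrite pseries_diffs_hyp0F1_coef// pseriesZ.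
by apply: cvgMr; apply: hyp0F1_cvg; rewrite ltr_wpDr.
Qed.

Lemma derive_hyp0F1 (R : realType) (nu u : R) : 0 < nu ->
  is_derive u 1 (hyp0F1 nu) (nu^-1 * hyp0F1 (nu + 1) u).
Proof.
move=> nu0.
have nu10 : 0 < nu + 1 by rewrite ltr_wpDr.
have <- : limn (pseries (pseries_diffs (hyp0F1_coef nu)) u) = nu^-1 * hyp0F1 (nu + 1) u.
  by apply: cvg_lim => //; exact: pseries_diffs_cvg.
apply: (@pseries_snd_diffs _ _ (`|u| + 1)).
- exact: is_cvg_hyp0F1.
- by apply/cvg_ex; eexists; exact: pseries_diffs_cvg.
- rewrite (pseries_diffs_hyp0F1_coef nu0).
  rewrite (_ : pseries_diffs _ =
      fun k => nu^-1 * pseries_diffs (hyp0F1_coef (nu + 1)) k); last first.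
    by apply/funext => k; rewrite /pseries_diffs mulrCA.
  rewrite pseriesZ; apply: is_cvgMr.
  by apply/cvg_ex; eexists; exact: pseries_diffs_cvg.
- by rewrite ltr_normr ltrDl ltr01.
Qed.

(** The contiguity relation, which is the differential equation
    F = nu F' + u F'' in disguise. On coefficients, c_nu(k) - c_(nu+1)(k) equals
    k c_(nu+1)(k) / nu, and the factor k is a differentiation. *)
Lemma hyp0F1_rec (R : realType) (nu u : R) : 0 < nu ->
  hyp0F1 nu u = hyp0F1 (nu + 1) u + u / nu * ((nu + 1)^-1 * hyp0F1 (nu + 1 + 1) u).
Proof.
move=> nu0; have nu10 : 0 < nu + 1 by rewrite ltr_wpDr.
apply: cvg_lim => //.
rewrite (_ : pseries (hyp0F1_coef nu) u = fun n => pseries (hyp0F1_coef (nu + 1)) u n +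
   u / nu * series (fun k => k%:R * hyp0F1_coef (nu + 1) k * u ^+ k.-1) n); last first.
  apply/funext => n; rewrite /pseries/series/= mulr_sumr -big_split/=.
  apply: eq_bigr => k _.
  have -> : hyp0F1_coef nu k = hyp0F1_coef (nu + 1) k + k%:R * hyp0F1_coef (nu + 1) k / nu.
    have p0 := lt0r_neq0 (poch_gt0 k nu0).
    have p1 := lt0r_neq0 (poch_gt0 k nu10).
    have k0 : k`!%:R != 0 :> R by rewrite gt_eqF// ltr0n fact_gt0.
    have := pochS nu k; rewrite pochSl => E.
    rewrite /hyp0F1_coef; apply/eqP; rewrite -subr_eq0; apply/eqP.
    transitivity ((nu * poch (nu + 1) k - poch nu k * (nu + k%:R)) /
       (k`!%:R * nu * poch nu k * poch (nu + 1) k)).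
      by field; rewrite p0 p1 k0 gt_eqF.
    by rewrite E subrr mul0r.
  case: k => [|k]; first by rewrite !mul0r addr0 mulr0 addr0.
  by rewrite /= exprS; ring.
apply: cvgD; first exact: hyp0F1_cvg.
apply: cvgMr.
have -> : (nu + 1)^-1 * hyp0F1 (nu + 1 + 1) u =
    limn (pseries (pseries_diffs (hyp0F1_coef (nu + 1))) u).
  by apply/esym/cvg_lim => //; exact: pseries_diffs_cvg.
apply: pseries_diffs_equiv.
by apply/cvg_ex; eexists; exact: pseries_diffs_cvg.
Qed.

Lemma hyp0F10 (R : realType) (nu : R) : 0 < nu -> hyp0F1 nu 0 = 1.
Proof.
move=> nu0; apply: lim_near_cst => //; near=> n.
have [m ->] : exists m, n = m.+1.
  by exists n.-1; rewrite prednK//; near: n; exists 1%N.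
rewrite /pseries/series/= big_nat_recl//= big1 ?addr0.
  by rewrite /hyp0F1_coef /poch big_ord0 expr0 fact0 !mulr1 invr1.
by move=> i _; rewrite expr0n mulr0.
Unshelve. all: by end_near. Qed.

Lemma le_hyp0F1 (R : realType) (nu nu' u u' : R) :
  0 < nu -> 0 < nu' ->
  (forall k, hyp0F1_coef nu k * u ^+ k <= hyp0F1_coef nu' k * u' ^+ k) ->
  hyp0F1 nu u <= hyp0F1 nu' u'.
Proof.
move=> nu0 nu'0 h; apply: ler_lim; [exact: is_cvg_hyp0F1|exact: is_cvg_hyp0F1|].
by near=> n; apply: ler_sum => k _; exact: h.
Unshelve. all: by end_near. Qed.

Lemma hyp0F1_ge1 (R : realType) (nu u : R) : 0 < nu -> 0 <= u -> 1 <= hyp0F1 nu u.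
Proof.
move=> nu0 u0; rewrite -[leLHS](hyp0F10 nu0); apply: le_hyp0F1 => // k.
rewrite ler_wpM2l ?hyp0F1_coef_ge0//; case: k => [|k]; first by rewrite !expr0.
by rewrite expr0n/= exprn_ge0.
Qed.

Lemma hyp0F1_gt0 (R : realType) (nu u : R) : 0 < nu -> 0 <= u -> 0 < hyp0F1 nu u.
Proof. by move=> nu0 u0; rewrite (lt_le_trans ltr01)// hyp0F1_ge1. Qed.

Lemma hyp0F1_antitone (R : realType) (nu nu' u : R) :
  0 < nu -> nu <= nu' -> 0 <= u -> hyp0F1 nu' u <= hyp0F1 nu u.
Proof.
move=> nu0 nn' u0; apply: le_hyp0F1 => // [|k]; first exact: lt_le_trans nn'.
by rewrite ler_wpM2r ?exprn_ge0// le_hyp0F1_coef.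
Qed.

Lemma hyp0F1_dilate (R : realType) (nu nu' u : R) :
  0 < nu -> nu <= nu' -> 0 <= u -> hyp0F1 nu u <= hyp0F1 nu' (u * (nu' / nu)).
Proof.
move=> nu0 nn' u0; have nu'0 := lt_le_trans nu0 nn'.
apply: le_hyp0F1 => // k; rewrite exprMn mulrCA mulrC ler_wpM2l ?exprn_ge0//.
have f0 : 0 < k`!%:R :> R by rewrite ltr0n fact_gt0.
rewrite /hyp0F1_coef [leRHS]mulrC ler_pdivlMr ?mulr_gt0 ?poch_gt0//.
rewrite mulrC ler_pdivrMr ?mulr_gt0 ?poch_gt0// mulrCA ler_pM2l//.
exact: le_poch_dilate.
Qed.

(** Joint continuity costs no uniform convergence: le_poch_dilate and
    monotonicity in the parameter trap F_(p y)(v y) between values of the single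
    function F_(p x), at v y and at the dilated point w y. *)
Lemma hyp0F1_continuous (R : realType) (p v : R -> R) (x : R) :
  (\forall y \near x, 0 <= v y) ->
  {for x, continuous p} -> {for x, continuous v} -> 0 < p x ->
  {for x, continuous (fun y => hyp0F1 (p y) (v y))}.
Proof.
move=> v0 cp cv px0.
pose w y := v y * (p x / p y).
have cS z : {for z, continuous (hyp0F1 (p x))}.
  exact: is_derive_continuous (derive_hyp0F1 _ px0).
have wx : w x = v x by rewrite /w divff ?mulr1// gt_eqF.
have cw : {for x, continuous w}.
  apply: cvgM => //; apply: cvgM; first exact: cvg_cst.
  by apply: cvgV => //; rewrite gt_eqF.
have c1 : {for x, continuous (fun y => hyp0F1 (p x) (v y))}.
  by apply: continuous_comp => //; exact: cS.
have c2 : {for x, continuous (fun y => hyp0F1 (p x) (w y))}.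
  by apply: continuous_comp => //; exact: cS.
apply: (@squeeze_cvgr _ _ _ _ (fun y => Num.min (hyp0F1 (p x) (v y)) (hyp0F1 (p x) (w y)))
   (fun y => Num.max (hyp0F1 (p x) (v y)) (hyp0F1 (p x) (w y)))).
- near=> y.
  have py0 : 0 < p y by near: y; exact: (cvgr_gt _ cp).
  have vy0 : 0 <= v y by near: y.
  have w0 : 0 <= w y by rewrite mulr_ge0// divr_ge0// ltW.
  rewrite ge_min le_max.
  have wE : v y = w y * (p y / p x).
    by rewrite /w; field; rewrite !gt_eqF.
  have [pxy|/ltW pyx] := leP (p x) (p y).
    rewrite (hyp0F1_antitone px0 pxy vy0) /=.
    by have := hyp0F1_dilate px0 pxy w0; rewrite -wE => ->; rewrite orbT.
  rewrite (hyp0F1_antitone py0 pyx vy0) /=.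
  by rewrite (hyp0F1_dilate py0 pyx vy0) orbT.
- have -> : hyp0F1 (p x) (v x) = Num.min (hyp0F1 (p x) (v x)) (hyp0F1 (p x) (w x)).
    by rewrite wx minxx.
  exact: (continuous_min c1 c2).
- have -> : hyp0F1 (p x) (v x) = Num.max (hyp0F1 (p x) (v x)) (hyp0F1 (p x) (w x)).
    by rewrite wx maxxx.
  exact: (continuous_max c1 c2).
Unshelve. all: by end_near. Qed.

(** * The Gamma function *)

Lemma measurable_fun_gt0 (R : realType) (f : R -> R) :
  (forall x : R, 0 < x -> {for x, continuous f}) -> measurable_fun `](0:R), +oo[ f.
Proof.
move=> cf; apply: open_continuous_measurable_fun; first exact: interval_open.
by move=> x; rewrite inE/= in_itv/= andbT => /cf.
Qed.

Lemma within_continuous_gt0 (R : realType) (f : R -> R) (a b : R) : 0 < a ->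
  (forall x : R, 0 < x -> {for x, continuous f}) -> {within `[a, b], continuous f}.
Proof.
move=> a0 cf; apply: continuous_in_subspaceT => x.
by rewrite inE/= in_itv/= => /andP[ax _]; apply: cf; exact: lt_le_trans ax.
Qed.

Lemma derivable_LR_gt0 (R : realType) (f df : R -> R) (a b : R) : 0 < a -> a < b ->
  (forall x : R, 0 < x -> is_derive x 1 f (df x)) -> derivable_oo_LRcontinuous f a b.
Proof.
move=> a0 ab hf; split.
- move=> x /[!in_itv]/= /andP[ax _]; have := hf x (lt_trans a0 ax) => h.
  exact: ex_derive.
- by apply: cvg_at_right_filter; exact: is_derive_continuous (hf _ a0).
- by apply: cvg_at_left_filter; exact: is_derive_continuous (hf _ (lt_trans a0 ab)).
Qed.

(** Integrals over the open half-line are computed as limits over compact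
    segments, because the Gamma integrand is unbounded at 0 when x < 1. *)
Lemma cvg_integral_gt0 (R : realType) (f : R -> R) (a b : R^nat) :
  (forall x, 0 < x -> 0 <= f x) -> measurable_fun `](0:R), +oo[ f ->
  (forall n, 0 < a n) ->
  (forall n m, (n <= m)%N -> a m <= a n) ->
  (forall n m, (n <= m)%N -> b n <= b m) ->
  (forall x, 0 < x -> exists n, a n <= x <= b n) ->
  (\int[lebesgue_measure]_(x in `[a n, b n]) (f x)%:E)%E @[n --> \oo] -->
  (\int[lebesgue_measure]_(x in `]0%R, +oo[) (f x)%:E)%E.
Proof.
move=> f0 mf a0 da ib ex.
have sub n : `[a n, b n] `<=` (`]0, +oo[%classic : set R).
  move=> x /=; rewrite !in_itv/= andbT => /andP[ax _]; exact: lt_le_trans ax.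
have -> : (`]0, +oo[%classic : set R) = \bigcup_n `[a n, b n]%classic.
  apply/seteqP; split=> x; last by case=> n _ /sub.
  rewrite /= in_itv/= andbT => /ex[n nx];
  by exists n.
apply: ge0_nondecreasing_set_cvg_integral.
- move=> n m nm; apply/subsetPset => x /=; rewrite !in_itv/= => /andP[anx xbn].
  by rewrite (le_trans (da _ _ nm) anx) (le_trans xbn (ib _ _ nm)).
- by [].
- move=> n; apply/measurable_EFinP.
  by apply: measurable_funS mf => //; exact: sub.
- by move=> n x /sub/=; rewrite in_itv/= andbT lee_fin => /f0.
Qed.

Lemma inv_exhaust (R : realType) (x : R) : 0 < x ->
  exists n : nat, (n.+1%:R)^-1 <= x <= n.+1%:R.
Proof.
move=> x0; exists (Num.trunc (x + x^-1)).
have h := truncnS_gt (x + x^-1).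
have i0 : 0 < x^-1 by rewrite invr_gt0.
have s0 : 0 < (Num.trunc (x + x^-1)).+1%:R :> R by rewrite ltr0n.
apply/andP; split; last by rewrite ltW// (le_lt_trans _ h)// lerDl ltW.
rewrite -[leRHS]invrK lef_pV2 ?posrE// ltW// (le_lt_trans _ h)// lerDr ltW//.
Qed.

Definition gamma_integrand (R : realType) (x t : R) : R := t `^ (x - 1) * expR (- t).

(** Kept in the extended reals, where the functional equation holds before
    finiteness is known and in fact yields it. *)
Definition gamma_integral (R : realType) (x : R) : \bar R :=
  (\int[lebesgue_measure]_(t in `]0%R, +oo[) (gamma_integrand x t)%:E)%E.

Lemma GammaE (R : realType) (x : R) : Gamma x = fine (gamma_integral x).
Proof. by []. Qed.

Lemma gamma_integrand_ge0 (R : realType) (x t : R) : 0 <= gamma_integrand x t.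
Proof. by rewrite mulr_ge0 ?powR_ge0 ?expR_ge0. Qed.

Lemma derive_expN (R : realType) (t : R) :
  is_derive t 1 (fun s => expR (- s)) (- expR (- t)).
Proof.
apply: is_derive_eq (derive_exp1 (deriveN1 (deriveI1 t))) _.
by rewrite mulrN1.
Qed.

Lemma gamma_integrand_continuous (R : realType) (x t : R) : 0 < t ->
  {for t, continuous (gamma_integrand x)}.
Proof.
move=> t0.
exact: is_derive_continuous (deriveM1 (is_derive1_powR (x - 1) t0) (derive_expN t)).
Qed.

Lemma measurable_gamma_integrand (R : realType) (x : R) :
  measurable_fun `](0:R), +oo[ (gamma_integrand x).
Proof. by apply: measurable_fun_gt0 => t; exact: gamma_integrand_continuous. Qed.

Lemma gamma_integral_ge0 (R : realType) (x : R) : (0 <= gamma_integral x)%E.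
Proof. by apply: integral_ge0 => t _; rewrite lee_fin gamma_integrand_ge0. Qed.

Lemma cvg_gamma_integral (R : realType) (x : R) :
  (\int[lebesgue_measure]_(t in `[(n.+1%:R)^-1%R, n.+1%:R]) (gamma_integrand x t)%:E)%E
     @[n --> \oo] --> gamma_integral x.
Proof.
apply: cvg_integral_gt0.
- by move=> t _; exact: gamma_integrand_ge0.
- exact: measurable_gamma_integrand.
- by move=> n; rewrite invr_gt0.
- by move=> n m nm; rewrite lef_pV2 ?posrE// ler_nat.
- by move=> n m nm; rewrite ler_nat.
- exact: inv_exhaust.
Qed.

(** The index is shifted to n + 2 to keep the segment nondegenerate. *)
Lemma gamma_integral_parts (R : realType) (x : R) (n : nat) : 0 < x ->
  let a := (n.+2%:R)^-1 : R in let b := n.+2%:R in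
  (\int[lebesgue_measure]_(t in `[a, b]) (gamma_integrand (x + 1) t)%:E =
  (a `^ x * expR (- a) - b `^ x * expR (- b))%:E +
  x%:E * \int[lebesgue_measure]_(t in `[a, b]) (gamma_integrand x t)%:E)%E.
Proof.
move=> x0 a b; have a0 : 0 < a by rewrite invr_gt0.
have ab : a < b by rewrite (@lt_trans _ _ 1) ?invf_lt1 ?ltr1n.
have dP (t : R) : 0 < t -> is_derive t 1 (fun t => t `^ x) (x * t `^ (x - 1)).
  exact: is_derive1_powR.
have dE (t : R) : 0 < t -> is_derive t 1 (fun s => - expR (- s)) (expR (- t)).
  by move=> _; rewrite -[X in is_derive _ _ _ X]opprK; apply: deriveN1; exact: derive_expN.
have := @integration_by_parts R (fun t => t `^ x) (fun t => - expR (- t))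
  (fun t => x * t `^ (x - 1)) (fun t => expR (- t)) a b ab.
have cf : {within `[a, b], continuous (fun t => x * t `^ (x - 1))}.
  apply: within_continuous_gt0 => // t t0.
  exact: is_derive_continuous (deriveM1 (deriveC1 x t) (is_derive1_powR (x - 1) t0)).
have cg : {within `[a, b], continuous (fun t => expR (- t))}.
  by apply: within_continuous_gt0 => // t t0; exact: is_derive_continuous (derive_expN t).
move=> /(_ cf (derivable_LR_gt0 a0 ab dP) _ cg (derivable_LR_gt0 a0 ab dE) _).
have F' : {in `]a, b[, (fun t => t `^ x)^`()%classic =1 (fun t => x * t `^ (x - 1))}.
  move=> t /[!in_itv]/= /andP[at_ _]; have := dP t (lt_trans a0 at_) => h.
  by rewrite derive1E derive_val.
have G' : {in `]a, b[, (fun t => - expR (- t))^`()%classic =1 (fun t => expR (- t))}.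
  move=> t /[!in_itv]/= /andP[at_ _]; have := dE t (lt_trans a0 at_) => h.
  by rewrite derive1E derive_val.
move=> /(_ F' G').
rewrite [X in X = _ -> _](_ : _ =
   (\int[lebesgue_measure]_(t in `[a, b]) (gamma_integrand (x + 1) t)%:E)%E); last first.
  by apply: eq_integral => t _; rewrite /gamma_integrand addrK.
move=> ->; congr (_%:E + _)%E; first by rewrite !mulrN opprK addrC.
rewrite (_ : (\int[lebesgue_measure]_(t in `[a, b]) (x * t `^ (x - 1) * - expR (- t))%:E)%E =
   (\int[lebesgue_measure]_(t in `[a, b]) (- (x%:E * (gamma_integrand x t)%:E)))%E); last first.
  by apply: eq_integral => t _; rewrite -EFinM -EFinN /gamma_integrand; congr (_%:E); ring.
rewrite integral_ge0N ?oppeK; last first.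
  by move=> t _; rewrite -EFinM lee_fin mulr_ge0 ?gamma_integrand_ge0// ltW.
rewrite ge0_integralZl//.
- apply/measurable_EFinP; apply: measurable_funS (measurable_gamma_integrand x) => //.
  by move=> t /=; rewrite !in_itv/= andbT => /andP[at_ _]; exact: lt_le_trans at_.
- by move=> t _; rewrite lee_fin gamma_integrand_ge0.
- by rewrite lee_fin ltW.
Qed.

(** The exponential is bounded below by one term of its series, of a degree k + 1
    exceeding x by at least 1. *)
Lemma cvg_powR_expN (R : realType) (x : R) :
  (n.+1%:R : R) `^ x * expR (- n.+1%:R) @[n --> \oo] --> 0.
Proof.
have [k xk] : exists k : nat, x <= k%:R.
  by exists (Num.trunc `|x|).+1; rewrite ltW// (le_lt_trans (ler_norm x))// truncnS_gt.
apply: (@squeeze_cvgr _ _ _ _ (fun=> 0) (fun n => (k.+1)`!%:R * harmonic n)).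
- near=> n; rewrite mulr_ge0 ?powR_ge0 ?expR_ge0//=.
  have n0 : 0 < n.+1%:R :> R by rewrite ltr0n.
  have f0 : 0 < k.+1`!%:R :> R by rewrite ltr0n fact_gt0.
  rewrite expRN ler_pdivrMr ?expR_gt0//.
  apply: (@le_trans _ _ (n.+1%:R ^+ k)).
    by rewrite -powR_mulrn ?ler0n// ler_powR// ler1n.
  rewrite mulrAC ler_pdivlMr//.
  have := @expR_ge1Dxn R n.+1%:R k (ltW n0).
  rewrite -(ler_pM2l f0) => /(le_trans _); apply.
  rewrite mulrDr mulrCA divff ?gt_eqF// !mulr1 exprSr lerDr ltW//.
- exact: cvg_cst.
- rewrite -[X in _ --> X](mulr0 (k.+1`!%:R : R)); apply: cvgM.
    exact: cvg_cst.
  exact: cvg_harmonic.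
Unshelve. all: by end_near. Qed.

Lemma cvg_inv_powR (R : realType) (x : R) : 0 < x ->
  ((n.+1%:R)^-1 : R) `^ x * expR (- (n.+1%:R)^-1) @[n --> \oo] --> 0.
Proof.
move=> x0.
apply: (@squeeze_cvgr _ _ _ _ (fun=> 0) (fun n => (harmonic n : R) `^ x)).
- near=> n; rewrite mulr_ge0 ?powR_ge0 ?expR_ge0//=.
  by rewrite ler_piMr ?powR_ge0// -expR0 ler_expR oppr_le0 invr_ge0.
- exact: cvg_cst.
- have /cvg_at_rightP := powR_cvg0 x0; apply; split; last exact: cvg_harmonic.
  by move=> n; rewrite /harmonic/= invr_gt0.
Unshelve. all: by end_near. Qed.

(** Integration by parts on [1/n, n]; both boundary terms vanish in the limit. *)
Lemma gamma_integral_rec (R : realType) (x : R) : 0 < x ->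
  gamma_integral (x + 1) = (x%:E * gamma_integral x)%E.
Proof.
move=> x0.
have shift (V : ptopologicalType) (u : nat -> V) (l : V) :
    u n @[n --> \oo] --> l -> u n.+1 @[n --> \oo] --> l.
  by rewrite -(@cvg_shiftS V u (nbhs l)).
have h1 := shift _ _ _ (@cvg_gamma_integral R (x + 1)).
have h2 := shift _ _ _ (@cvg_gamma_integral R x).
move: h1; rewrite (_ : (fun n => _) = (fun n : nat =>
   (((n.+2%:R)^-1 `^ x * expR (- (n.+2%:R)^-1) - n.+2%:R `^ x * expR (- n.+2%:R))%:E +
   x%:E * \int[lebesgue_measure]_(t in `[(n.+2%:R)^-1%R, n.+2%:R]) (gamma_integrand x t)%:E)%E));
  last by apply/funext => n; rewrite gamma_integral_parts.
move=> h1.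
have h3 : (((n.+2%:R)^-1 `^ x * expR (- (n.+2%:R)^-1) -
     n.+2%:R `^ x * expR (- n.+2%:R))%:E +
   x%:E * \int[lebesgue_measure]_(t in `[(n.+2%:R)^-1%R, n.+2%:R]) (gamma_integrand x t)%:E)%E
   @[n --> \oo] --> (0%:E + x%:E * gamma_integral x)%E.
  apply: cvgeD; first by rewrite fin_num_adde_defr.
    apply: cvg_EFin; first by near=> n.
    rewrite -[X in _ --> X](subr0 (0 : R)); apply: cvgB.
      exact: (shift _ _ _ (@cvg_inv_powR R _ x0)).
    exact: (shift _ _ _ (@cvg_powR_expN R x)).
  by apply: cvgeZl.
by have := cvg_unique _ h1 h3; rewrite add0e; apply; exact: ereal_hausdorff.
Unshelve. all: by end_near. Qed.

Lemma gamma_integral1_lty (R : realType) : (gamma_integral (1 : R) < +oo)%E.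
Proof.
apply: (@le_lt_trans _ _ 1%E); last exact: ltry.
rewrite -(cvg_lim _ (@cvg_gamma_integral R 1)); last exact: ereal_hausdorff.
apply: lime_le; first by apply/cvg_ex; eexists; exact: cvg_gamma_integral.
near=> n; have [m ->] : exists m, n = m.+1.
  by exists n.-1; rewrite prednK//; near: n; exists 1%N.
have a0 : 0 < (m.+2%:R)^-1 :> R by rewrite invr_gt0.
have ab : (m.+2%:R)^-1 < m.+2%:R :> R.
  by rewrite (@lt_trans _ _ 1) ?invf_lt1 ?ltr1n.
have dE (t : R) : 0 < t -> is_derive t 1 (fun s => - expR (- s)) (expR (- t)).
  by move=> _; rewrite -[X in is_derive _ _ _ X]opprK; apply: deriveN1; exact: derive_expN.
rewrite (@continuous_FTC2 R (gamma_integrand 1) (fun s => - expR (- s))) //.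
- rewrite -EFinB lee_fin opprK addrC.
  apply: (@le_trans _ _ (expR (- (m.+2%:R)^-1))); first by rewrite gerBl expR_ge0.
  by rewrite -expR0 ler_expR oppr_le0 ltW.
- by apply: within_continuous_gt0 => // t; exact: gamma_integrand_continuous.
- exact: (derivable_LR_gt0 a0 ab dE).
- move=> t /[!in_itv]/= /andP[at_ _]; have := dE t (lt_trans a0 at_) => h.
  by rewrite derive1E derive_val /gamma_integrand subrr powRr0 mul1r.
Unshelve. all: by end_near. Qed.

(** Finiteness at positive integers follows from the recursion. For t^x the bound
    1 + t^n with n >= x gives it at x + 1, and the recursion brings it down to x. *)
Lemma gamma_integral_lty (R : realType) (x : R) : 0 < x -> (gamma_integral x < +oo)%E.
Proof.
move=> x0.
have nat_lty (n : nat) : (gamma_integral (n.+1%:R : R) < +oo)%E.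
  elim: n => [|n ih]; first exact: gamma_integral1_lty.
  by rewrite -natr1 gamma_integral_rec ?ltr0n// lte_mul_pinfty// ?lee_fin.
suff : (gamma_integral (x + 1) < +oo)%E.
  rewrite gamma_integral_rec//; have := gamma_integral_ge0 x.
  case: (gamma_integral x) => [r| |] // _.
    by move=> _; exact: ltry.
  by rewrite gt0_muley ?lte_fin.
have [n xn] : exists n : nat, x <= n%:R.
  by exists (Num.trunc x).+1; rewrite ltW// truncnS_gt.
have mEF y : measurable_fun `](0:R), +oo[ (fun t => (gamma_integrand y t)%:E).
  by apply/measurable_EFinP; exact: measurable_gamma_integrand.
apply: (@le_lt_trans _ _ (gamma_integral (1 : R) + gamma_integral (n.+1%:R : R))%E); last first.
  exact: lte_add_pinfty (gamma_integral1_lty R) (nat_lty n).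
have g0 y (t : R) : `]0, +oo[%classic t -> (0 <= (gamma_integrand y t)%:E)%E.
  by move=> _; rewrite lee_fin gamma_integrand_ge0.
have -> : (gamma_integral (1 : R) + gamma_integral (n.+1%:R : R))%E =
    (\int[lebesgue_measure]_(t in `]0%R, +oo[)
       ((gamma_integrand 1 t)%:E + (gamma_integrand n.+1%:R t)%:E))%E.
  by rewrite ge0_integralD; [|by []|exact: g0|exact: mEF|exact: g0|exact: mEF].
apply: ge0_le_integral => //.
- exact: g0.
- exact: mEF.
- by apply: emeasurable_funD; exact: mEF.
- move=> t /=; rewrite in_itv/= andbT => t0.
  rewrite -EFinD lee_fin /gamma_integrand -mulrDl ler_wpM2r ?expR_ge0//.
  rewrite subrr powRr0 addrK -natr1 addrK.
  have [t1|/ltW t1] := leP 1 t.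
    by apply: (le_trans (ler_powR t1 xn)); rewrite lerDr.
  rewrite (@le_trans _ _ 1)//; last by rewrite lerDl powR_ge0.
  rewrite -[leRHS](powRr0 t) ger_powR ?t0 ?t1//; exact: ltW.
Qed.

Lemma gamma_integral_gt0 (R : realType) (x : R) : 0 < x -> (0 < gamma_integral x)%E.
Proof.
move=> x0.
have mEF : measurable_fun `](0:R), +oo[ (fun t => (gamma_integrand x t)%:E).
  by apply/measurable_EFinP; exact: measurable_gamma_integrand.
have sub : `[1, 2] `<=` (`]0, +oo[%classic : set R).
  by move=> t /=; rewrite !in_itv/= andbT => /andP[t1 _]; exact: lt_le_trans t1.
apply: (@lt_le_trans _ _
  (\int[lebesgue_measure]_(t in `[1%R, 2%R]) (gamma_integrand x t)%:E)%E); last first.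
  by apply: ge0_subset_integral => // t _; rewrite lee_fin gamma_integrand_ge0.
apply: (@lt_le_trans _ _
  (\int[lebesgue_measure]_(t in `[1%R, 2%R]) (cst (2^-1 * expR (-2))%:E t))%E); last first.
  apply: ge0_le_integral => //.
  - by move=> t _; rewrite lee_fin mulr_ge0 ?expR_ge0.
  - exact: measurable_funS mEF.
  - move=> t /=; rewrite in_itv/= => /andP[t1 t2].
    rewrite lee_fin ler_pM ?expR_ge0 ?ler_expR ?lerN2//.
    apply: (@le_trans _ _ (t `^ (-1))); last by rewrite ler_powR// lerBrDr; lra.
    have t0 : 0 < t by exact: lt_le_trans t1.
    by rewrite powR_inv1 ?(ltW t0)// lef_pV2 ?posrE.
rewrite integral_cst//= lebesgue_measure_itv/= lte_fin ltr1n.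
by rewrite -EFinB -EFinM lte_fin !mulr_gt0 ?invr_gt0 ?expR_gt0//; lra.
Qed.

Lemma gamma_integral_fin_num (R : realType) (x : R) : 0 < x -> gamma_integral x \is a fin_num.
Proof. by move=> x0; rewrite ge0_fin_numE ?gamma_integral_ge0// gamma_integral_lty. Qed.

Lemma gamma_integral_Gamma (R : realType) (x : R) : 0 < x -> gamma_integral x = (Gamma x)%:E.
Proof. by move=> x0; rewrite GammaE fineK// gamma_integral_fin_num. Qed.

Lemma Gamma_gt0 (R : realType) (x : R) : 0 < x -> 0 < Gamma x.
Proof. by move=> x0; rewrite -lte_fin -gamma_integral_Gamma// gamma_integral_gt0. Qed.

Lemma GammaS (R : realType) (x : R) : 0 < x -> Gamma (x + 1) = x * Gamma x.
Proof.
move=> x0; apply: EFin_inj; rewrite EFinM -!gamma_integral_Gamma ?gamma_integral_rec//.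
by rewrite ltr_wpDr.
Qed.

(** * The noncentral chi density has mass one *)

Definition gauss_integrand (R : realType) (x t : R) : R :=
  t `^ (2 * x - 1) * expR (- (t ^+ 2 / 2)).

Lemma gauss_integrand_ge0 (R : realType) (x t : R) : 0 <= gauss_integrand x t.
Proof. by rewrite mulr_ge0 ?powR_ge0 ?expR_ge0. Qed.

Lemma derive_halfsq (R : realType) (t : R) : is_derive t 1 (fun s : R => s ^+ 2 / 2) t.
Proof.
have h := deriveM1 (deriveM1 (deriveI1 t) (deriveI1 t)) (deriveC1 (2^-1) t).
apply: is_derive_eq h _; lra.
Qed.

Lemma gauss_integrand_continuous (R : realType) (x t : R) : 0 < t ->
  {for t, continuous (gauss_integrand x)}.
Proof.
move=> t0; exact: is_derive_continuous (deriveM1 (is_derive1_powR (2 * x - 1) t0)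
  (derive_exp1 (deriveN1 (derive_halfsq t)))).
Qed.

Lemma measurable_gauss_integrand (R : realType) (x : R) :
  measurable_fun `](0:R), +oo[ (gauss_integrand x).
Proof. by apply: measurable_fun_gt0 => t; exact: gauss_integrand_continuous. Qed.

Lemma gauss_moment_segment (R : realType) (x a b : R) : 0 < a -> a < b ->
  (\int[lebesgue_measure]_(t in `[(a ^+ 2 / 2)%R, (b ^+ 2 / 2)%R]) (gamma_integrand x t)%:E =
   (2 `^ (1 - x))%:E * \int[lebesgue_measure]_(t in `[a, b]) (gauss_integrand x t)%:E)%E.
Proof.
move=> a0 ab; pose F (t : R) := t ^+ 2 / 2.
have F' : F^`()%classic = id.
  by apply/funext => t; have h := derive_halfsq t; rewrite derive1E derive_val.
have := @integration_by_substitution_increasing R F (gamma_integrand x) a b (ltW ab).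
move=> -> //.
- rewrite F' -ge0_integralZl//.
  + apply: eq_integral => t; rewrite inE/= in_itv/= => /andP[at_ _].
    have t0 : 0 < t by exact: lt_le_trans at_.
    rewrite -EFinM; congr EFin; rewrite -[LHS]/(gamma_integrand x (t ^+ 2 / 2) * t).
    have E : (t ^+ 2 / 2) `^ (x - 1) * t = 2 `^ (1 - x) * t `^ (2 * x - 1).
      rewrite powRM ?exprn_ge0 ?(ltW t0)// -powR_inv1// -powRrM.
      rewrite -powR_mulrn ?(ltW t0)// -powRrM mulN1r opprB.
      rewrite [LHS]mulrAC mulrC -[X in _ * (_ * X)](powRr1 (ltW t0)) -powRD.
        by congr (_ * _ `^ _); ring.
      by rewrite (gt_eqF t0) implybT.
    by rewrite /gamma_integrand mulrAC E /gauss_integrand mulrA.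
  + apply/measurable_EFinP; apply: measurable_funS (measurable_gauss_integrand x) => //.
    by move=> t /=; rewrite !in_itv/= andbT => /andP[at_ _]; exact: lt_le_trans at_.
  + by move=> t _; rewrite lee_fin gauss_integrand_ge0.
- move=> u v /[!in_itv]/= /andP[au _] /andP[av _] uv.
  by rewrite /F ltr_pM2r ?invr_gt0// ltr_pXn2r// nnegrE (le_trans (ltW a0)).
- by rewrite F' => t _; exact: cvg_id.
- by rewrite F'; apply/cvg_ex; exists a; apply: cvg_at_right_filter; exact: cvg_id.
- by rewrite F'; apply/cvg_ex; exists b; apply: cvg_at_left_filter; exact: cvg_id.
- by apply: (derivable_LR_gt0 a0 ab) => t _; exact: derive_halfsq.
- apply: within_continuous_gt0 => [|t]; last exact: gamma_integrand_continuous.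
  by rewrite /F divr_gt0// exprn_gt0.
Qed.

(** The substitution s = t^2 / 2 in Euler's integral. *)
Lemma gauss_moment (R : realType) (x : R) : 0 < x ->
  (\int[lebesgue_measure]_(t in `]0%R, +oo[) (gauss_integrand x t)%:E)%E =
  (2 `^ (x - 1) * Gamma x)%:E.
Proof.
move=> x0; pose a n : R := (n.+2%:R)^-1; pose b n : R := n.+2%:R.
have a0 n : 0 < a n by rewrite invr_gt0.
have ab n : a n < b n by rewrite (@lt_trans _ _ 1) ?invf_lt1 ?ltr1n.
have da n m : (n <= m)%N -> a m <= a n by move=> nm; rewrite lef_pV2 ?posrE// ler_nat.
have ib n m : (n <= m)%N -> b n <= b m by move=> nm; rewrite ler_nat.
have ex (y : R) : 0 < y -> exists n, a n <= y <= b n.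
  move=> /inv_exhaust[n /andP[h1 h2]]; exists n; apply/andP; split.
    by apply: le_trans h1; rewrite lef_pV2 ?posrE// ler_nat.
  by apply: (le_trans h2); rewrite ler_nat.
have h1 := cvg_integral_gt0 (fun t _ => gauss_integrand_ge0 x t)
  (measurable_gauss_integrand x) a0 da ib ex.
have h2 : (\int[lebesgue_measure]_(t in `[(a n ^+ 2 / 2)%R, (b n ^+ 2 / 2)%R])
    (gamma_integrand x t)%:E)%E @[n --> \oo] --> gamma_integral x.
  apply: (@cvg_integral_gt0 _ (gamma_integrand x) (fun n => a n ^+ 2 / 2) (fun n => b n ^+ 2 / 2)).
  - by move=> t _; exact: gamma_integrand_ge0.
  - exact: measurable_gamma_integrand.
  - by move=> n; rewrite divr_gt0// exprn_gt0.
  - by move=> n m nm; rewrite ler_pM2r ?invr_gt0// lerXn2r ?nnegrE ?da// ltW.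
  - by move=> n m nm; rewrite ler_pM2r ?invr_gt0// lerXn2r ?nnegrE ?ib// /b ler0n.
  - move=> y y0; have s0 : 0 < Num.sqrt (2 * y) by rewrite sqrtr_gt0 mulr_gt0.
    have [n /andP[u v]] := ex _ s0; exists n.
    have sE : Num.sqrt (2 * y) ^+ 2 = 2 * y by rewrite sqr_sqrtr// mulr_ge0// ltW.
    rewrite ler_pdivrMr// ler_pdivlMr// mulrC -sE.
    by rewrite !lerXn2r ?nnegrE// ltW// (lt_trans (a0 n)).
have h3 : (\int[lebesgue_measure]_(t in `[(a n ^+ 2 / 2)%R, (b n ^+ 2 / 2)%R])
    (gamma_integrand x t)%:E)%E @[n --> \oo] --> ((2 `^ (1 - x))%:E *
  \int[lebesgue_measure]_(t in `]0%R, +oo[) (gauss_integrand x t)%:E)%E.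
  under eq_fun do rewrite gauss_moment_segment//.
  exact: cvgeZl.
have := cvg_unique (@ereal_hausdorff R) h2 h3.
rewrite gamma_integral_Gamma// => E; rewrite EFinM E muleA -EFinM -powRD.
  by rewrite (_ : x - 1 + (1 - x) = 0) ?powRr0 ?mul1e//; ring.
by rewrite (gt_eqF (ltr0n _ 2)) implybT.
Qed.

Lemma nneseries_EFin (R : realType) (u : nat -> R) (l : R) :
  series u @ \oo --> l -> (\sum_(k <oo) (u k)%:E)%E = l%:E.
Proof.
move=> ul; rewrite -(cvg_lim _ ul)// -EFin_lim; last by apply/cvg_ex; exists l.
by apply/congr_lim/funext => n/=; rewrite /series/= -sumEFin.
Qed.

Lemma Gamma_poch (R : realType) (nu : R) k : 0 < nu ->
  Gamma (nu + k%:R) = Gamma nu * poch nu k.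
Proof.
move=> nu0; elim: k => [|k ih]; first by rewrite addr0 /poch big_ord0 mulr1.
by rewrite -natr1 addrA GammaS ?ltr_wpDr// ih pochS mulrC mulrA.
Qed.

(** Density of the noncentral chi law with 2 nu degrees of freedom and
    noncentrality a; at a = 0 it is the central one. *)
Definition chi_density (R : realType) (nu a t : R) : R :=
  (2 `^ (nu - 1) * Gamma nu)^-1 * expR (- (a ^+ 2 / 2)) *
  (gauss_integrand nu t * hyp0F1 nu (a ^+ 2 * t ^+ 2 / 4)).

(** Poisson weight with mean a^2 / 2 times the central chi density of order
    nu + k: the k-th term of chi_density when hyp0F1 is expanded. *)
Definition chi_mixture_term (R : realType) (nu a : R) (k : nat) (t : R) : R :=
  (2 `^ (nu - 1) * Gamma nu)^-1 * expR (- (a ^+ 2 / 2)) *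
  (a ^+ 2 / 4) ^+ k * hyp0F1_coef nu k * gauss_integrand (nu + k%:R) t.

Lemma chi_mixture_term_ge0 (R : realType) (nu a : R) k t :
  0 < nu -> 0 <= chi_mixture_term nu a k t.
Proof.
move=> nu0; rewrite /chi_mixture_term mulr_ge0 ?gauss_integrand_ge0// mulr_ge0 ?hyp0F1_coef_ge0//.
rewrite mulr_ge0 ?exprn_ge0 ?divr_ge0 ?sqr_ge0//.
by rewrite mulr_ge0 ?expR_ge0// invr_ge0 mulr_ge0 ?powR_ge0// ltW// Gamma_gt0.
Qed.

Lemma chi_mixture_term_series (R : realType) (nu a t : R) : 0 < nu -> 0 < t ->
  (\sum_(k <oo) (chi_mixture_term nu a k t)%:E)%E = (chi_density nu a t)%:E.
Proof.
move=> nu0 t0; apply: nneseries_EFin.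
pose c := (2 `^ (nu - 1) * Gamma nu)^-1 * expR (- (a ^+ 2 / 2)) * gauss_integrand nu t.
rewrite (_ : series _ = fun n => c * pseries (hyp0F1_coef nu) (a ^+ 2 * t ^+ 2 / 4) n).
  have -> : chi_density nu a t = c * hyp0F1 nu (a ^+ 2 * t ^+ 2 / 4) by rewrite /chi_density mulrA.
  by apply: cvgMr; exact: hyp0F1_cvg.
apply/funext => n; rewrite /pseries/series/= mulr_sumr; apply: eq_bigr => k _.
have -> : chi_mixture_term nu a k t =
    c * (hyp0F1_coef nu k * ((a ^+ 2 / 4) ^+ k * (t ^+ 2) ^+ k)).
  rewrite /chi_mixture_term /c /gauss_integrand.
  have -> : t `^ (2 * (nu + k%:R) - 1) = t `^ (2 * nu - 1) * (t ^+ 2) ^+ k.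
    rewrite -exprM -(powR_mulrn _ (ltW t0)) -powRD; last by rewrite (gt_eqF t0) implybT.
    by congr (_ `^ _); rewrite natrM; ring.
  ring.
by rewrite -exprMn; congr (_ * (_ * _ ^+ _)); ring.
Qed.

Lemma integral_chi_mixture_term (R : realType) (nu a : R) k : 0 < nu ->
  (\int[lebesgue_measure]_(t in `]0%R, +oo[) (chi_mixture_term nu a k t)%:E)%E =
  (expR (- (a ^+ 2 / 2)) * exp_coeff (a ^+ 2 / 2) k)%:E.
Proof.
move=> nu0; rewrite /chi_mixture_term.
set c := (2 `^ (nu - 1) * Gamma nu)^-1 * _ * _ * _.
have c0 : 0 <= c.
  rewrite mulr_ge0 ?hyp0F1_coef_ge0// mulr_ge0 ?exprn_ge0 ?divr_ge0 ?sqr_ge0//.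
  by rewrite mulr_ge0 ?expR_ge0// invr_ge0 mulr_ge0 ?powR_ge0// ltW// Gamma_gt0.
under eq_integral do rewrite EFinM.
rewrite ge0_integralZl//; last 2 first.
- by apply/measurable_EFinP; exact: measurable_gauss_integrand.
- by move=> t _; rewrite lee_fin gauss_integrand_ge0.
rewrite gauss_moment ?ltr_wpDr// -EFinM; congr EFin.
rewrite Gamma_poch// addrAC powRD; last by rewrite (gt_eqF (ltr0n _ 2)) implybT.
rewrite powR_mulrn// /c /hyp0F1_coef /exp_coeff /=.
have -> : a ^+ 2 / 2 = a ^+ 2 / 4 * 2 by field.
rewrite [(a ^+ 2 / 4 * 2) ^+ k]exprMn; set q := (a ^+ 2 / 4) ^+ k.
have G0 := lt0r_neq0 (Gamma_gt0 nu0); have p0 := lt0r_neq0 (poch_gt0 k nu0).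
have k0 : k`!%:R != 0 :> R by rewrite gt_eqF// ltr0n fact_gt0.
have t0 : 2 `^ (nu - 1) != 0 :> R by rewrite gt_eqF// powR_gt0.
by field; rewrite G0 p0 k0 t0.
Qed.

Lemma measurable_chi_mixture_term (R : realType) (nu a : R) k :
  measurable_fun `](0:R), +oo[ (chi_mixture_term nu a k).
Proof. by apply: measurable_funM => //; exact: measurable_gauss_integrand. Qed.

(** Summed under the integral sign, the mixture leaves the total mass of a
    Poisson law. *)
Lemma integral_chi_density (R : realType) (nu a : R) : 0 < nu ->
  (\int[lebesgue_measure]_(t in `]0%R, +oo[) (chi_density nu a t)%:E)%E = 1%E.
Proof.
move=> nu0.
rewrite (_ : (\int[lebesgue_measure]_(t in _) _)%E =
  (\int[lebesgue_measure]_(t in `]0%R, +oo[) \sum_(k <oo) (chi_mixture_term nu a k t)%:E)%E); last first.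
  apply: eq_integral => t; rewrite inE/= in_itv/= andbT => t0.
  by rewrite chi_mixture_term_series.
rewrite integral_nneseries//; last 2 first.
- by move=> k; apply/measurable_EFinP; exact: measurable_chi_mixture_term.
- by move=> k t _; rewrite lee_fin chi_mixture_term_ge0.
rewrite (eq_eseriesr (fun k _ => integral_chi_mixture_term a k nu0)).
apply: nneseries_EFin.
rewrite (_ : series _ = fun n => expR (- (a ^+ 2 / 2)) * series (exp_coeff (a ^+ 2 / 2)) n).
  rewrite -[X in _ --> X](mulVf (lt0r_neq0 (expR_gt0 (a ^+ 2 / 2)))) -expRN.
  by apply: cvgMr; exact: is_cvg_series_exp_coeff.
by apply/funext => n; rewrite /series/= mulr_sumr.
Qed.

(** * The Riccati equation of a Bessel quotient *)

(** The derivative of hyp0F1 in u, by derive_hyp0F1. *)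
Definition dhyp0F1 (R : realType) (nu u : R) : R := nu^-1 * hyp0F1 (nu + 1) u.

(** With u = x^2 / 4 this is x d/dx applied to F, since x d/dx = 2 u d/du. *)
Definition euler0F1 (R : realType) (nu u : R) : R := 2 * u * dhyp0F1 nu u.

Lemma dhyp0F1_gt0 (R : realType) (nu u : R) : 0 < nu -> 0 <= u -> 0 < dhyp0F1 nu u.
Proof. by move=> nu0 u0; rewrite mulr_gt0 ?invr_gt0 ?hyp0F1_gt0// ltr_wpDr. Qed.

Lemma euler0F1_ge0 (R : realType) (nu u : R) : 0 < nu -> 0 <= u -> 0 <= euler0F1 nu u.
Proof. by move=> nu0 u0; apply: mulr_ge0; [exact: mulr_ge0|exact/ltW/dhyp0F1_gt0]. Qed.

Lemma euler0F1_le (R : realType) (nu u : R) : 0 < nu -> 0 <= u ->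
  nu * euler0F1 nu u <= 2 * u * hyp0F1 nu u.
Proof.
move=> nu0 u0; rewrite /euler0F1 /dhyp0F1.
rewrite (_ : nu * _ = 2 * u * hyp0F1 (nu + 1) u); last by field; rewrite gt_eqF.
by rewrite ler_wpM2l ?mulr_ge0// hyp0F1_antitone// lerDl.
Qed.

Lemma derive_euler0F1 (R : realType) (nu u : R) : 0 < nu ->
  is_derive u 1 (euler0F1 nu) (2 * hyp0F1 nu u - (2 * nu - 2) * dhyp0F1 nu u).
Proof.
move=> nu0; have nu10 : 0 < nu + 1 by rewrite ltr_wpDr.
have h := deriveM1 (deriveM1 (deriveC1 2 u) (deriveI1 u))
  (deriveM1 (deriveC1 nu^-1 u) (derive_hyp0F1 u nu10)).
apply: is_derive_eq h _; rewrite (hyp0F1_rec u nu0) /dhyp0F1.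
by field; rewrite !gt_eqF.
Qed.

(** A Turan-type inequality, equivalent to the quotient 2 u F' / F being
    nondecreasing. The difference T of the two sides satisfies
    (nu - 1) T + u T' = 4 u F^2 >= 0, so the sign of T propagates from small u
    to every u. Near 0 the sign is clear from nu * (2 u F') <= 2 u F. *)
Lemma turan_hyp0F1 (R : realType) (nu u : R) : 0 < nu -> 0 < u ->
  euler0F1 nu u ^+ 2 + (2 * nu - 2) * euler0F1 nu u * hyp0F1 nu u <= 4 * u * hyp0F1 nu u ^+ 2.
Proof.
move=> nu0 u0; pose A := hyp0F1 nu; pose Y := euler0F1 nu.
pose T x := 4 * x * (A x * A x) - (2 * nu - 2) * (Y x * A x) - Y x * Y x.
suff : 0 <= T u by rewrite /T /A /Y !expr2; lra.
(* e is a starting point at which T is nonnegative: nu^2 T(e) is bounded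
   below by a multiple of nu - e or of nu^2 - e, according to the sign of nu - 1 *)
pose e := Num.min u (Num.min nu (nu * nu)).
have e0 : 0 < e by rewrite !lt_min u0 nu0 mulr_gt0.
have [eu [en en2]] : e <= u /\ e <= nu /\ e <= nu * nu.
  by rewrite !ge_min !lexx !orbT.
have Te : 0 <= T e.
  have Yle : nu * Y e <= 2 * e * A e by exact: euler0F1_le (ltW e0).
  have Y0 : 0 <= Y e by exact: euler0F1_ge0 (ltW e0).
  have A0 : 0 < A e by exact: hyp0F1_gt0 (ltW e0).
  suff : 0 <= nu * nu * T e by rewrite pmulr_rge0// mulr_gt0.
  have h1 : nu * Y e * (nu * Y e) <= 2 * e * A e * (2 * e * A e).
    by apply: ler_pM => //; rewrite mulr_ge0// ltW.
  have [nu1|nu1] := leP 1 nu.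
    have h2 : nu * Y e * ((2 * nu - 2) * nu * A e) <=
              2 * e * A e * ((2 * nu - 2) * nu * A e).
      by apply: ler_wpM2r Yle; rewrite !mulr_ge0 ?(ltW A0) ?(ltW nu0)//; lra.
    apply: (@le_trans _ _ (4 * e * (A e * A e) * (nu - e))).
      by rewrite !mulr_ge0 ?subr_ge0// ltW.
    by rewrite /T; lra.
  have h2 : 0 <= (2 - 2 * nu) * (Y e * A e) * (nu * nu).
    apply: mulr_ge0; last by rewrite mulr_ge0// ltW.
    by apply: mulr_ge0; [lra|exact: mulr_ge0 Y0 (ltW A0)].
  apply: (@le_trans _ _ (4 * e * (A e * A e) * (nu * nu - e))).
    by rewrite !mulr_ge0 ?subr_ge0// ltW.
  by rewrite /T; lra.
pose dT x := 4 * (A x * A x) + 4 * x * (2 * (A x * dhyp0F1 nu x))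
  - (2 * nu - 2) * ((2 * A x - (2 * nu - 2) * dhyp0F1 nu x) * A x + Y x * dhyp0F1 nu x)
  - 2 * Y x * (2 * A x - (2 * nu - 2) * dhyp0F1 nu x).
have hT : e `^ (nu - 1) * T e <= u `^ (nu - 1) * T u.
  apply: (@powR_weight_nondecreasing _ (nu - 1) T dT _ _ e0 eu) => x /andP[ex _].
    have dA := derive_hyp0F1 x nu0; have dY := derive_euler0F1 x nu0.
    have h := deriveD1 (deriveD1 (deriveM1 (deriveM1 (deriveC1 4 x) (deriveI1 x))
        (deriveM1 dA dA))
      (deriveN1 (deriveM1 (deriveC1 (2 * nu - 2) x) (deriveM1 dY dA))))
      (deriveN1 (deriveM1 dY dY)).
    by apply: is_derive_eq h _; rewrite /dT /A /Y /dhyp0F1; ring.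
  have -> : (nu - 1) * T x + x * dT x = 4 * x * (A x * A x).
    by rewrite /T /dT /Y /euler0F1; ring.
  have x0 := lt_le_trans e0 ex.
  by rewrite !mulr_ge0 ?(ltW x0)// ltW// hyp0F1_gt0// ltW.
rewrite -(pmulr_rge0 _ (powR_gt0 (nu - 1) u0)).
by apply: le_trans hT; rewrite mulr_ge0 ?powR_ge0.
Qed.

(** x I_nu(x) / I_(nu-1)(x) at u = x^2 / 4, see bessel_ratio. *)
Definition bessel_quot (R : realType) (nu u : R) : R := euler0F1 nu u / hyp0F1 nu u.

Definition dbessel_quot (R : realType) (nu u : R) : R :=
  (2 * hyp0F1 nu u - (2 * nu - 2) * dhyp0F1 nu u) / hyp0F1 nu u -
  euler0F1 nu u * dhyp0F1 nu u / hyp0F1 nu u ^+ 2.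

Lemma derive_bessel_quot (R : realType) (nu u : R) : 0 < nu -> 0 <= u ->
  is_derive u 1 (bessel_quot nu) (dbessel_quot nu u).
Proof.
move=> nu0 u0; have A0 : hyp0F1 nu u != 0 by rewrite gt_eqF// hyp0F1_gt0.
have h := deriveM1 (derive_euler0F1 u nu0) (deriveV1 A0 (derive_hyp0F1 u nu0)).
by apply: is_derive_eq h _; rewrite /dbessel_quot -/(dhyp0F1 nu u) mulNr mulrN mulrA.
Qed.

Lemma bessel_quot_ode (R : realType) (nu u : R) : 0 < nu -> 0 <= u ->
  2 * u * dbessel_quot nu u = 4 * u - (2 * nu - 2) * bessel_quot nu u - bessel_quot nu u ^+ 2.
Proof.
move=> nu0 u0; have A0 : hyp0F1 nu u != 0 by rewrite gt_eqF// hyp0F1_gt0.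
by rewrite /dbessel_quot /bessel_quot /euler0F1; field; rewrite A0.
Qed.

Lemma bessel_quot_ge0 (R : realType) (nu u : R) : 0 < nu -> 0 <= u -> 0 <= bessel_quot nu u.
Proof. by move=> nu0 u0; rewrite divr_ge0 ?euler0F1_ge0// ltW// hyp0F1_gt0. Qed.

Lemma bessel_quot_nondecreasing (R : realType) (nu u v : R) :
  0 < nu -> 0 < u -> u <= v -> bessel_quot nu u <= bessel_quot nu v.
Proof.
move=> nu0 u0 uv.
apply: (@nondecreasing_derive _ (bessel_quot nu) (dbessel_quot nu) _ _ uv) => x /andP[ux _].
  by apply: derive_bessel_quot => //; rewrite ltW// (lt_le_trans u0).
have x0 := lt_le_trans u0 ux; have A0 := hyp0F1_gt0 nu0 (ltW x0).
rewrite -(@pmulr_rge0 _ (2 * x)) ?mulr_gt0// bessel_quot_ode ?(ltW x0)//.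
have := turan_hyp0F1 nu0 x0; rewrite -subr_ge0 => h.
rewrite (_ : _ - _ = (4 * x * hyp0F1 nu x ^+ 2 - (euler0F1 nu x ^+ 2 +
   (2 * nu - 2) * euler0F1 nu x * hyp0F1 nu x)) / hyp0F1 nu x ^+ 2).
  by rewrite divr_ge0// exprn_ge0// ltW.
by rewrite /bessel_quot; field; rewrite gt_eqF.
Qed.

(** The inequality amos_gap >= 0 is an Amos-type lower bound for the quotient
    y = x I_nu / I_(nu-1), namely x^2 <= y^2 + (2 nu - 1)(y + 1). It expresses
    that the second logarithmic derivative of chi_density is at most -1. *)
Definition amos_gap (R : realType) (nu u : R) : R :=
  bessel_quot nu u ^+ 2 + (2 * nu - 1) * bessel_quot nu u + (2 * nu - 1) - 4 * u.

Definition amos_numer (R : realType) (nu u : R) : R :=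
  euler0F1 nu u * euler0F1 nu u + (2 * nu - 1) * (euler0F1 nu u * hyp0F1 nu u) +
  (2 * nu - 1 - 4 * u) * (hyp0F1 nu u * hyp0F1 nu u).

Lemma amos_numerE (R : realType) (nu u : R) : 0 < nu -> 0 <= u ->
  amos_numer nu u = hyp0F1 nu u ^+ 2 * amos_gap nu u.
Proof.
move=> nu0 u0; rewrite /amos_numer /amos_gap /bessel_quot; field.
by rewrite gt_eqF// hyp0F1_gt0.
Qed.

Definition damos_numer (R : realType) (nu u : R) : R :=
  let Y := euler0F1 nu u in let A := hyp0F1 nu u in let B := dhyp0F1 nu u in
  let dY := 2 * A - (2 * nu - 2) * B in
  2 * (Y * dY) + (2 * nu - 1) * (dY * A + Y * B) - 4 * (A * A) +
  (2 * nu - 1 - 4 * u) * (2 * (A * B)).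

Lemma derive_amos_numer (R : realType) (nu u : R) : 0 < nu ->
  is_derive u 1 (amos_numer nu) (damos_numer nu u).
Proof.
move=> nu0; have dA := derive_hyp0F1 u nu0; have dY := derive_euler0F1 u nu0.
have h := deriveD1 (deriveD1 (deriveM1 dY dY)
    (deriveM1 (deriveC1 (2 * nu - 1) u) (deriveM1 dY dA)))
  (deriveM1 (deriveD1 (deriveC1 (2 * nu - 1) u)
     (deriveN1 (deriveM1 (deriveC1 4 u) (deriveI1 u)))) (deriveM1 dA dA)).
by apply: is_derive_eq h _; rewrite /damos_numer /dhyp0F1; ring.
Qed.

(** The key identity. Since amos_numer is F^2 W with W = amos_gap, it says that
    u^(nu - 3/2) F^2 W increases or decreases according to the sign of y - (3 - 2 nu). *)
Lemma amos_numer_weight (R : realType) (nu u : R) : 0 < nu -> 0 < u ->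
  (nu - 3 / 2) * amos_numer nu u + u * damos_numer nu u =
  (2 * nu - 1) / 2 * hyp0F1 nu u ^+ 2 * (bessel_quot nu u - (3 - 2 * nu)).
Proof.
move=> nu0 u0; rewrite /damos_numer /amos_numer /bessel_quot /euler0F1; field.
by rewrite gt_eqF// hyp0F1_gt0// ltW.
Qed.

Lemma amos_gap_ge0_sign (R : realType) (nu u : R) : 0 < nu -> 0 < u ->
  (0 <= u `^ (nu - 3 / 2) * amos_numer nu u) = (0 <= amos_gap nu u).
Proof.
move=> nu0 u0; rewrite pmulr_rge0 ?powR_gt0// amos_numerE ?(ltW u0)//.
by rewrite pmulr_rge0// exprn_gt0// hyp0F1_gt0// ltW.
Qed.

Lemma amos_gap_forward (R : realType) (nu u0 u : R) : 1 / 2 <= nu ->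
  0 < u0 -> u0 <= u -> 3 - 2 * nu <= bessel_quot nu u0 -> 0 <= amos_gap nu u0 ->
  0 <= amos_gap nu u.
Proof.
move=> nu12 u00 u0u hy; have nu0 : 0 < nu by lra.
rewrite -!amos_gap_ge0_sign//; last exact: lt_le_trans u0u.
move=> /le_trans; apply.
apply: (@powR_weight_nondecreasing _ _ (amos_numer nu) (damos_numer nu) _ _ u00 u0u).
  by move=> x _; exact: derive_amos_numer.
move=> x /andP[u0x xu]; have x0 := lt_le_trans u00 u0x.
rewrite amos_numer_weight// !mulr_ge0 ?invr_ge0 ?exprn_ge0 ?(ltW (hyp0F1_gt0 _ (ltW x0)))//.
  by lra.
by rewrite subr_ge0 (le_trans hy)// bessel_quot_nondecreasing.
Qed.

Lemma amos_gap_backward (R : realType) (nu u0 u : R) : 1 / 2 <= nu ->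
  0 < u -> u <= u0 -> bessel_quot nu u0 <= 3 - 2 * nu -> 0 <= amos_gap nu u0 ->
  0 <= amos_gap nu u.
Proof.
move=> nu12 u00 u0u hy; have nu0 : 0 < nu by lra.
rewrite -!amos_gap_ge0_sign//; last exact: lt_le_trans u0u.
move=> /le_trans; apply; rewrite -lerN2 -!mulrN.
apply: (@powR_weight_nondecreasing _ _ (fun u => - amos_numer nu u)
  (fun u => - damos_numer nu u) _ _ u00 u0u).
  by move=> x _; apply: deriveN1; exact: derive_amos_numer.
move=> x /andP[u0x xu]; have x0 := lt_le_trans u00 u0x.
rewrite !mulrN -opprD amos_numer_weight// -mulrN.
rewrite !mulr_ge0 ?invr_ge0 ?exprn_ge0 ?(ltW (hyp0F1_gt0 _ (ltW x0)))//.
  by lra.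
by rewrite oppr_ge0 subr_le0 (le_trans _ hy)// bessel_quot_nondecreasing.
Qed.

Lemma amos_gap_small (R : realType) (nu u : R) : 1 / 2 <= nu -> 0 <= u ->
  4 * u <= 2 * nu - 1 -> 0 <= amos_gap nu u.
Proof.
move=> nu12 u0 hu; have nu0 : 0 < nu by lra.
have y0 := bessel_quot_ge0 nu0 u0.
have h1 : 0 <= bessel_quot nu u ^+ 2 by rewrite exprn_ge0.
have h2 : 0 <= (2 * nu - 1) * bessel_quot nu u by rewrite mulr_ge0//; lra.
by rewrite /amos_gap; lra.
Qed.

(** Here 3 - 2 nu <= 0 <= y, so the weighted gap increases from a small u, where
    the gap is nonnegative. *)
Lemma amos_gap_ge0_large (R : realType) (nu u : R) : 3 / 2 <= nu -> 0 < u ->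
  0 <= amos_gap nu u.
Proof.
move=> nu32 u0; have nu0 : 0 < nu by lra.
have [hu|hu] := leP (4 * u) (2 * nu - 1); first by apply: amos_gap_small; lra.
apply: (@amos_gap_forward _ nu ((2 * nu - 1) / 4)); try lra.
  by apply: le_trans (bessel_quot_ge0 nu0 _); lra.
by apply: amos_gap_small; lra.
Qed.

(** As y is nondecreasing, the weighted gap is minimal at the point c where
    y = 3 - 2 nu. There the gap is 5 - 2 nu - 4 c, which is nonnegative exactly
    when c is to the left of (5 - 2 nu) / 4. *)
Lemma amos_gap_ge0_critical (R : realType) (nu u : R) : 1 / 2 <= nu -> nu < 3 / 2 ->
  3 - 2 * nu <= bessel_quot nu ((5 - 2 * nu) / 4) -> 0 < u -> 0 <= amos_gap nu u.
Proof.
move=> nu12 nu32 hstar u0; have nu0 : 0 < nu by lra.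
have u1 : 0 < (5 - 2 * nu) / 4 by lra.
have [c] : exists2 c, c \in `[0, (5 - 2 * nu) / 4] & bessel_quot nu c = 3 - 2 * nu.
  have b0 : bessel_quot nu 0 = 0 by rewrite /bessel_quot /euler0F1 mulr0 !mul0r.
  apply: IVT; first exact: ltW.
    apply: derivable_within_continuous => x /[!in_itv]/= /andP[x0 _].
    have h := derive_bessel_quot nu0 x0; exact: ex_derive.
  by rewrite b0 ge_min le_max hstar orbT andbT; apply/orP; left; lra.
rewrite in_itv/= => /andP[]; rewrite le_eqVlt => /predU1P[<- _|c0 cu bc].
  by rewrite /bessel_quot /euler0F1 mulr0 !mul0r => h; exfalso; lra.
have Wc : 0 <= amos_gap nu c by rewrite /amos_gap bc; lra.
have [cu'|/ltW uc] := leP c u.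
  by apply: (@amos_gap_forward _ nu c) => //; rewrite bc.
by apply: (@amos_gap_backward _ nu c) => //; rewrite bc.
Qed.

(** * Bessel functions and the critical order *)

Lemma besselI_hyp0F1 (R : realType) (mu t : R) : 0 < mu + 1 -> 0 < t ->
  besselI mu t = (t / 2) `^ mu / Gamma (mu + 1) * hyp0F1 (mu + 1) (t ^+ 2 / 4).
Proof.
move=> mu0 t0; apply: cvg_lim => //.
rewrite (_ : series _ = fun n => (t / 2) `^ mu / Gamma (mu + 1) *
    pseries (hyp0F1_coef (mu + 1)) (t ^+ 2 / 4) n).
  by apply: cvgMr; exact: hyp0F1_cvg.
apply/funext => n; rewrite /pseries/series/= mulr_sumr; apply: eq_bigr => k _.
have t20 : 0 < t / 2 by rewrite divr_gt0.
rewrite (addrAC mu) Gamma_poch// /hyp0F1_coef.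
rewrite powRD; last by rewrite (gt_eqF t20) implybT.
rewrite -natrM (powR_mulrn _ (ltW t20)) exprM.
have -> : (t / 2) ^+ 2 = t ^+ 2 / 4 by field.
have G0 := lt0r_neq0 (Gamma_gt0 mu0); have p0 := lt0r_neq0 (poch_gt0 k mu0).
have k0 : k`!%:R != 0 :> R by rewrite gt_eqF// ltr0n fact_gt0.
set q := (_ / _) ^+ k; move: k0 p0 G0; move: (k`!%:R) (poch _ _) (Gamma _) => x y z x0 y0 z0.
by field; rewrite x0 y0 z0.
Qed.

Lemma bessel_ratio (R : realType) (nu t : R) : 0 < nu -> 0 < t ->
  besselI nu t / besselI (nu - 1) t = bessel_quot nu (t ^+ 2 / 4) / t.
Proof.
move=> nu0 t0; have nu10 : 0 < nu + 1 by rewrite ltr_wpDr.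
rewrite !besselI_hyp0F1 ?subrK// GammaS//.
have t20 : 0 < t / 2 by rewrite divr_gt0.
have -> : (t / 2) `^ nu = (t / 2) `^ (nu - 1) * (t / 2).
  have := @powRD _ (t / 2) (nu - 1) 1; rewrite (gt_eqF t20) implybT subrK => ->//.
  by rewrite powRr1// ltW.
have u0 : 0 <= t ^+ 2 / 4 by rewrite divr_ge0 ?sqr_ge0.
rewrite /bessel_quot /euler0F1 /dhyp0F1.
have G0 := lt0r_neq0 (Gamma_gt0 nu0).
have p0 : (t / 2) `^ (nu - 1) != 0 by rewrite gt_eqF// powR_gt0.
have A0 := lt0r_neq0 (hyp0F1_gt0 nu0 u0).
move: G0 p0 A0 (hyp0F1 (nu + 1) _).
move: (Gamma nu) ((t / 2) `^ _) (hyp0F1 nu _) => x y z x0 y0 z0 w.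
by field; rewrite x0 y0 z0 !gt_eqF.
Qed.

Lemma nu0_equationP (R : realType) (nu : R) : 0 < nu -> nu < 5 / 2 ->
  nu0_equation nu <-> bessel_quot nu ((5 - 2 * nu) / 4) = 3 - 2 * nu.
Proof.
move=> nu0 nu52; have p0 : 0 < 5 - 2 * nu by lra.
have s0 : 0 < Num.sqrt (5 - 2 * nu) by rewrite sqrtr_gt0.
rewrite /nu0_equation bessel_ratio// sqr_sqrtr ?(ltW p0)//.
split=> [/(mulIf _)->//|->//].
by rewrite invr_eq0 gt_eqF.
Qed.

Lemma bessel_quot_critical_continuous (R : realType) (x : R) : 0 < x -> x < 5 / 2 ->
  {for x, continuous (fun nu : R => bessel_quot nu ((5 - 2 * nu) / 4) - (3 - 2 * nu))}.
Proof.
move=> x0 x52.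
have dl (c d : R) : is_derive x 1 (fun nu => (c - 2 * nu) / d)
    ((0 - (0 * x + 2 * 1)) * d^-1 + (c - 2 * x) * 0).
  exact: deriveM1 (deriveD1 (deriveC1 c x)
    (deriveN1 (deriveM1 (deriveC1 2 x) (deriveI1 x)))) (deriveC1 d^-1 x).
have cv : {for x, continuous (fun nu : R => (5 - 2 * nu) / 4)}.
  exact: is_derive_continuous (dl 5 4).
have v0 : \forall y \near x, 0 <= (5 - 2 * y) / 4.
  near=> y; apply: ltW; near: y; apply: (cvgr_gt _ cv); lra.
have c1 := hyp0F1_continuous v0 (@cvg_id _ _) cv x0.
have c2 : {for x, continuous (fun nu : R => hyp0F1 (nu + 1) ((5 - 2 * nu) / 4))}.
  apply: (hyp0F1_continuous v0 _ cv); last by lra.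
  exact: is_derive_continuous (derive_shift 1 x).
have c3 : {for x, continuous (fun nu : R => nu^-1)}.
  by apply: cvgV; [rewrite gt_eqF|exact: cvg_id].
apply: cvgB; last first.
  have := is_derive_continuous (dl 3 1).
  rewrite (_ : (fun nu : R => (3 - 2 * nu) / 1) = (fun nu => 3 - 2 * nu)) => [//|].
  by apply/funext => y; rewrite divr1.
apply: cvgM; last first.
  by apply: cvgV => //; rewrite gt_eqF// hyp0F1_gt0//; lra.
apply: cvgM; first by apply: cvgM => //; exact: cvg_cst.
by apply: cvgM.
Unshelve. all: by end_near. Qed.

(** At nu = 3/2 the quotient is strictly above 3 - 2 nu = 0. Were it below for some
    nu in [nu0, 3/2), continuity in nu would produce a second solution of the
    equation for nu0. *)
Lemma nu0_critical (R : realType) (nu0 nu : R) : is_nu0 nu0 ->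
  nu0 <= nu -> nu < 3 / 2 -> 3 - 2 * nu <= bessel_quot nu ((5 - 2 * nu) / 4).
Proof.
move=> [[/andP[n0 n1] e0] uniq] le0 nu32.
have nu0E := (@nu0_equationP _ nu0 ltac:(lra) ltac:(lra)).1 e0.
rewrite leNgt; apply/negP => lt3.
have [c] : exists2 c, c \in `[nu, 3 / 2] &
    bessel_quot c ((5 - 2 * c) / 4) - (3 - 2 * c) = 0.
  apply: (@IVT _ (fun nu => bessel_quot nu ((5 - 2 * nu) / 4) - (3 - 2 * nu))).
  - exact: ltW.
  - apply: continuous_in_subspaceT => x; rewrite inE/= in_itv/= => /andP[a b].
    by apply: bessel_quot_critical_continuous; lra.
  - rewrite ge_min le_max; apply/andP; split; apply/orP; [left|right]; first lra.
    have : 0 <= bessel_quot (3 / 2 : R) ((5 - 2 * (3 / 2)) / 4) by apply: bessel_quot_ge0; lra.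
    lra.
rewrite in_itv/= => /andP[nuc c32] Ec.
have [cE|cN] := eqVneq c (3 / 2).
  move: Ec; rewrite cE => Ec.
  have : 0 < bessel_quot (3 / 2 : R) ((5 - 2 * (3 / 2)) / 4).
    have n32 : 0 < 3 / 2 :> R by lra.
    have b0 : 0 < (5 - 2 * (3 / 2)) / 4 :> R by lra.
    apply: divr_gt0; last exact: hyp0F1_gt0 (ltW b0).
    by apply: mulr_gt0; [rewrite mulr_gt0|exact: dhyp0F1_gt0 (ltW b0)].
  lra.
have c3 : c < 3 / 2 by rewrite lt_neqAle cN.
have : nu0 = c.
  apply: uniq; split; first by apply/andP; split; lra.
  by apply/nu0_equationP; lra.
move=> E; have nuE : nu = nu0 by apply/eqP; rewrite eq_le le0 andbT E.
by move: lt3; rewrite nuE nu0E ltxx.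
Qed.

Lemma amos_gap_ge0_nu0 (R : realType) (nu0 nu u : R) : is_nu0 nu0 ->
  nu0 <= nu -> 0 < u -> 0 <= amos_gap nu u.
Proof.
move=> h le0 u0; have [/andP[n0 n1] _] := h.1.
have [nu32|nu32] := leP (3 / 2) nu; first exact: amos_gap_ge0_large.
by apply: amos_gap_ge0_critical; rewrite ?nu32//; [lra|exact: nu0_critical h _ _].
Qed.

(** * Log-concavity of the noncentral chi distribution function *)

(** The logarithmic derivative of chi_density in t. *)
Definition chi_score (R : realType) (nu a t : R) : R :=
  (2 * nu - 1) / t - t + bessel_quot nu (a ^+ 2 * t ^+ 2 / 4) / t.

Lemma derive_argument (R : realType) (a t : R) :
  is_derive t 1 (fun s => a ^+ 2 * s ^+ 2 / 4) (a ^+ 2 * t / 2).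
Proof.
have h := deriveM1 (deriveM1 (deriveC1 (a ^+ 2) t) (deriveM1 (deriveI1 t) (deriveI1 t)))
   (deriveC1 (4^-1) t).
by apply: is_derive_eq h _; field.
Qed.

Lemma argument_ge0 (R : realType) (a t : R) : 0 <= a ^+ 2 * t ^+ 2 / 4.
Proof. by rewrite divr_ge0// mulr_ge0// sqr_ge0. Qed.

Lemma chi_density_const_gt0 (R : realType) (nu a : R) : 0 < nu ->
  0 < (2 `^ (nu - 1) * Gamma nu)^-1 * expR (- (a ^+ 2 / 2)).
Proof.
move=> nu0; apply: mulr_gt0; last exact: expR_gt0.
by rewrite invr_gt0 mulr_gt0 ?powR_gt0// Gamma_gt0.
Qed.

Lemma chi_density_gt0 (R : realType) (nu a t : R) : 0 < nu -> 0 < t ->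
  0 < chi_density nu a t.
Proof.
move=> nu0 t0; apply: mulr_gt0; first exact: chi_density_const_gt0.
apply: mulr_gt0; last by rewrite hyp0F1_gt0// argument_ge0.
by rewrite mulr_gt0 ?powR_gt0 ?expR_gt0.
Qed.

Lemma chi_density_ge0 (R : realType) (nu a t : R) : 0 < nu -> 0 <= chi_density nu a t.
Proof.
move=> nu0; apply: mulr_ge0; first exact/ltW/chi_density_const_gt0.
by apply: mulr_ge0; [exact: gauss_integrand_ge0|rewrite ltW// hyp0F1_gt0// argument_ge0].
Qed.

Lemma derive_chi_density (R : realType) (nu a t : R) : 0 < nu -> 0 < t ->
  is_derive t 1 (chi_density nu a) (chi_density nu a t * chi_score nu a t).
Proof.
move=> nu0 t0.
have h := deriveM1 (deriveC1 ((2 `^ (nu - 1) * Gamma nu)^-1 * expR (- (a ^+ 2 / 2))) t)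
  (deriveM1 (deriveM1 (is_derive1_powR (2 * nu - 1) t0)
              (derive_exp1 (deriveN1 (derive_halfsq t))))
     (@derive_comp1 _ (hyp0F1 nu) (fun s => a ^+ 2 * s ^+ 2 / 4) t _ _
       (derive_hyp0F1 (a ^+ 2 * t ^+ 2 / 4) nu0) (derive_argument a t))).
apply: is_derive_eq h _; rewrite /chi_density /gauss_integrand /chi_score.
rewrite /bessel_quot /euler0F1 -/(dhyp0F1 _ _).
have -> : t `^ (2 * nu - 1) = t `^ (2 * nu - 1 - 1) * t.
  have := @powRD _ t (2 * nu - 1 - 1) 1; rewrite (gt_eqF t0) implybT subrK => ->//.
  by rewrite powRr1// ltW.
have A0 := lt0r_neq0 (hyp0F1_gt0 nu0 (argument_ge0 a t)).
move: A0 ((2 `^ _ * Gamma _)^-1 * _) (expR _) (t `^ _) (dhyp0F1 _ _).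
move: (hyp0F1 nu _) => A A0 c e p B.
by field; rewrite A0 gt_eqF.
Qed.

(** By the Riccati equation bessel_quot_ode, the numerator is
    - (amos_gap + t^2). *)
Lemma derive_chi_score (R : realType) (nu a t : R) : 0 < nu -> 0 < t ->
  is_derive t 1 (chi_score nu a)
    ((a ^+ 2 * t ^+ 2 - (2 * nu - 1) * bessel_quot nu (a ^+ 2 * t ^+ 2 / 4) -
      bessel_quot nu (a ^+ 2 * t ^+ 2 / 4) ^+ 2 - (2 * nu - 1) - t ^+ 2) / t ^+ 2).
Proof.
move=> nu0 t0; have tn0 := lt0r_neq0 t0; have u0 := argument_ge0 a t.
have dV : is_derive t 1 (fun s => s^-1) (- 1 / t ^+ 2).
  exact: deriveV1 tn0 (deriveI1 t).
have h := deriveD1 (deriveD1 (deriveM1 (deriveC1 (2 * nu - 1) t) dV)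
   (deriveN1 (deriveI1 t)))
  (deriveM1 (@derive_comp1 _ (bessel_quot nu) (fun s => a ^+ 2 * s ^+ 2 / 4) t _ _
     (derive_bessel_quot nu0 u0) (derive_argument a t)) dV).
apply: is_derive_eq h _.
have := bessel_quot_ode nu0 u0; set u := a ^+ 2 * t ^+ 2 / 4; set y := bessel_quot nu u.
set d := dbessel_quot nu u => ode.
have E : d * (a ^+ 2 * t / 2) = (4 * u - (2 * nu - 2) * y - y ^+ 2) / t.
  by rewrite -ode /u; field.
by rewrite E /u; field.
Qed.

Lemma chi_density_shift (R : realType) (nu a : R) : 0 < nu ->
  (forall t, 0 < t -> 0 <= amos_gap nu (a ^+ 2 * t ^+ 2 / 4) + t ^+ 2) ->
  forall t b d : R, 0 < t -> t <= b -> 0 <= d ->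
  chi_density nu a t * chi_density nu a (b + d) <=
  chi_density nu a b * chi_density nu a (t + d).
Proof.
move=> nu0 h.
apply: (log_concave_shift (fun x x0 => chi_density_gt0 a nu0 x0)
   (fun x x0 => derive_chi_density a nu0 x0) (fun x x0 => derive_chi_score a nu0 x0)).
move=> t t0; rewrite ler_pdivrMr ?exprn_gt0// mul0r.
by have := h t t0; rewrite /amos_gap; lra.
Qed.

Lemma measurable_chi_density (R : realType) (nu a : R) : 0 < nu ->
  measurable_fun `](0:R), +oo[ (chi_density nu a).
Proof.
move=> nu0; apply: measurable_fun_gt0 => t t0.
exact: is_derive_continuous (derive_chi_density a nu0 t0).
Qed.

Lemma integrable_chi_density (R : realType) (nu a : R) (i : interval R) : 0 < nu ->
  (BLeft 0 <= i.1)%O ->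
  lebesgue_measure.-integrable [set` i] (EFin \o chi_density nu a).
Proof.
move=> nu0 i0.
have m0 := (measurable_fun_itv_obnd_cbndP _ _ _).1 (measurable_chi_density a nu0).
have int0 : lebesgue_measure.-integrable `[0, +oo[ (EFin \o chi_density nu a).
  apply/integrableP; split; first exact/measurable_EFinP.
  rewrite -integral_itv_obnd_cbnd; last first.
    by apply: measurableT_comp => //; apply/measurable_EFinP; exact: measurable_chi_density.
  rewrite (_ : (\int[lebesgue_measure]_(x in _) _)%E =
      (\int[lebesgue_measure]_(t in `]0%R, +oo[) (chi_density nu a t)%:E)%E).
    by rewrite integral_chi_density// ltry.
  by apply: eq_integral => t _ /=; rewrite ger0_norm// chi_density_ge0.
apply: integrableS int0 => //.
by move: i i0 => [l r]/= i0; apply: subset_itv => //; exact: lex1.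
Qed.

Definition chi_cdf (R : realType) (nu a b : R) : R :=
  \int[lebesgue_measure]_(t in `[0, b]) chi_density nu a t.

Lemma chi_density_tail (R : realType) (nu a b : R) : 0 < nu -> 0 <= b ->
  \int[lebesgue_measure]_(t in `]b, +oo[) chi_density nu a t = 1 - chi_cdf nu a b.
Proof.
move=> nu0 b0; rewrite -(@Rintegral_itvB _ _ (BLeft 0) +oo%O b) ?bnd_simp//; last first.
  by apply: integrable_chi_density => //=; rewrite bnd_simp.
congr (_ - _); rewrite -Rintegral_itv_obnd_cbnd; last first.
  by apply: integrable_chi_density => //=; rewrite bnd_simp.
by rewrite /Rintegral integral_chi_density.
Qed.

Lemma marcum_density_chi_density (R : realType) (nu a t : R) : 0 < nu -> 0 < a -> 0 < t ->
  marcum_density nu a t = chi_density nu a t.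
Proof.
move=> nu0 a0 t0; have at0 : 0 < a * t by rewrite mulr_gt0.
rewrite /marcum_density besselI_hyp0F1 ?subrK// /chi_density /gauss_integrand exprMn.
rewrite (_ : - ((t ^+ 2 + a ^+ 2) / 2) = - (a ^+ 2 / 2) + - (t ^+ 2 / 2)); last by field.
rewrite expRD.
have -> : (a * t / 2) `^ (nu - 1) = a `^ (nu - 1) * t `^ (nu - 1) / 2 `^ (nu - 1).
  rewrite powRM ?(ltW at0)// powRM ?ltW//.
  by rewrite -powR_inv1// -powRrM mulN1r powRN.
have -> : t `^ (2 * nu - 1) = t `^ nu * t `^ (nu - 1).
  rewrite -powRD; last by rewrite (gt_eqF t0) implybT.
  by congr (_ `^ _); ring.
have G0 := lt0r_neq0 (Gamma_gt0 nu0).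
have p0 : 2 `^ (nu - 1) != 0 :> R by rewrite gt_eqF// powR_gt0.
have q0 : a `^ (nu - 1) != 0 by rewrite gt_eqF// powR_gt0.
move: p0 q0 G0 (t `^ nu) (t `^ (nu - 1)) (expR _) (expR _) (hyp0F1 _ _).
move: (2 `^ _) (a `^ _) (Gamma _) => x y z x0 y0 z0 p q r s v.
by field; rewrite x0 y0 z0.
Qed.

Lemma marcumQ_pos_chi_cdf (R : realType) (nu a b : R) : 0 < nu -> 0 < a -> 0 <= b ->
  marcumQ_pos nu a b = 1 - chi_cdf nu a b.
Proof.
move=> nu0 a0 b0; rewrite -chi_density_tail// /marcumQ_pos.
have sub (t : R) : t \in (`]b, +oo[ : set R)%classic ->
    marcum_density nu a t = chi_density nu a t.
  rewrite inE/= in_itv/= andbT => bt; apply: marcum_density_chi_density => //.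
  exact: le_lt_trans bt.
have im : lebesgue_measure.-integrable `]b, +oo[ (EFin \o marcum_density nu a).
  have ib : (BLeft 0 <= BRight b)%O by rewrite bnd_simp.
  apply: eq_integrable (@integrable_chi_density _ nu a `]b, +oo[ nu0 ib) => //.
  by move=> t tb; rewrite /= sub.
rewrite -Rintegral_itv_obnd_cbnd//.
by apply: eq_Rintegral => t; exact: sub.
Qed.

(** The term k = 0 of the Poisson mixture. *)
Lemma chi_density_ge_central (R : realType) (nu a t : R) : 0 < nu ->
  expR (- (a ^+ 2 / 2)) * chi_density nu 0 t <= chi_density nu a t.
Proof.
move=> nu0; rewrite /chi_density expr0n/= !mul0r oppr0 expR0 mulr1 hyp0F10// mulr1.
rewrite mulrCA mulrA ler_wpM2l ?(ltW (chi_density_const_gt0 a nu0))//.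
by rewrite ler_peMr ?gauss_integrand_ge0// hyp0F1_ge1// argument_ge0.
Qed.

(** By chi_density_ge_central, with w = exp(-a^2/2), both the tail and the
    distribution function at a are at least w times their values at 0; as the two
    add up to 1, this squeezes the tail. *)
Lemma marcumQ_pos_cvg0 (R : realType) (nu b : R) : 0 < nu -> 0 <= b ->
  marcumQ_pos nu a b @[a --> 0^'+] --> 1 - chi_cdf nu 0 b.
Proof.
move=> nu0 b0; pose w (a : R) := expR (- (a ^+ 2 / 2)).
have cw : w a @[a --> 0^'+] --> (1 : R).
  have -> : 1 = w 0 by rewrite /w expr0n/= mul0r oppr0 expR0.
  apply: cvg_at_right_filter.
  exact: is_derive_continuous (derive_exp1 (deriveN1 (derive_halfsq (0 : R)))).
have lb (i : interval R) (a : R) : (BLeft 0 <= i.1)%O ->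
    w a * \int[lebesgue_measure]_(t in [set` i]) chi_density nu 0 t <=
    \int[lebesgue_measure]_(t in [set` i]) chi_density nu a t.
  move=> i0; rewrite -RintegralZl//; last exact: integrable_chi_density.
  apply: le_Rintegral => //; last by move=> t _; exact: chi_density_ge_central.
    have := integrable_chi_density 0 nu0 i0.
    by move=> /(integrableZl _ (w a)) wint; apply: eq_integrable (wint _).
  exact: integrable_chi_density.
set q := 1 - chi_cdf nu 0 b.
apply: (@squeeze_cvgr _ _ _ _ (fun a => w a * q) (fun a => 1 - w a * (1 - q))).
- near=> a; rewrite marcumQ_pos_chi_cdf//; apply/andP; split.
    rewrite /q -!chi_density_tail//; apply: lb; by rewrite bnd_simp.
  rewrite /q subKr lerD2l lerN2; apply: lb; by rewrite bnd_simp.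
- by rewrite -[X in _ --> X](mul1r q); apply: cvgM => //; exact: cvg_cst.
- have E : 1 - 1 * (1 - q) = q by ring.
  rewrite -[X in _ --> X]E.
  by apply: cvgB; [exact: cvg_cst|apply: cvgM => //; exact: cvg_cst].
Unshelve. all: by end_near. Qed.

Lemma marcumQ_chi_cdf (R : realType) (nu a b : R) : 0 < nu -> 0 <= a -> 0 <= b ->
  1 - marcumQ nu a b = chi_cdf nu a b.
Proof.
move=> nu0 a0 b0; rewrite /marcumQ; case: eqVneq => [->|an0].
  by rewrite (cvg_lim _ (marcumQ_pos_cvg0 nu0 b0))// subKr.
by rewrite marcumQ_pos_chi_cdf ?subKr// lt_neqAle eq_sym an0.
Qed.

Lemma log_concave_chi_cdf (R : realType) (nu a : R) : 0 < nu ->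
  (forall t, 0 < t -> 0 <= amos_gap nu (a ^+ 2 * t ^+ 2 / 4) + t ^+ 2) ->
  log_concave_on `[0, +oo[ (chi_cdf nu a).
Proof.
move=> nu0 h.
have int0 (b : R) : lebesgue_measure.-integrable `[0, b] (EFin \o chi_density nu a).
  by apply: integrable_chi_density => //=; rewrite bnd_simp.
apply: (@log_concave_on_primitive _ (chi_density nu a)).
- by rewrite /chi_cdf set_itv1 Rintegral_set1.
- move=> b b0; exact: (parameterized_integral_continuous (ltW b0) (int0 b)).
- move=> x x0; have := @continuous_FTC1_closed R (chi_density nu a) 0 x (x + 1).
  rewrite ltrDl ltr01; move=> /(_ isT (int0 _) x0).
  move=> /(_ (is_derive_continuous (derive_chi_density a nu0 x0))).
  by rewrite derive1E => -[d1 d2]; apply: DeriveDef.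
- by move=> x; exact: chi_density_gt0.
- exact: chi_density_shift.
Qed.

Theorem corollary1 (R : realType) (nu a : R) :
  (1 / 2 <= nu /\ 0 <= a <= 1) \/
  (exists2 nu0 : R, is_nu0 nu0 & nu0 <= nu /\ 0 <= a) ->
  log_concave_on `[0, +oo[ (fun b => 1 - marcumQ nu a b).
Proof.
move=> hyp.
have [nu0 a0 h] : [/\ 0 < nu, 0 <= a &
    forall t, 0 < t -> 0 <= amos_gap nu (a ^+ 2 * t ^+ 2 / 4) + t ^+ 2].
  case: hyp => [[nu12 /andP[a0 a1]]|[nu0 nu0P [nu0nu a0]]].
    have nu0 : 0 < nu by lra.
    split=> // t t0; have y0 := bessel_quot_ge0 nu0 (argument_ge0 a t).
    have h1 : 0 <= (2 * nu - 1) * bessel_quot nu (a ^+ 2 * t ^+ 2 / 4).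
      by rewrite mulr_ge0//; lra.
    have h2 : a ^+ 2 * t ^+ 2 <= t ^+ 2.
      by rewrite ler_piMl ?sqr_ge0// exprn_ile1.
    have := sqr_ge0 (bessel_quot nu (a ^+ 2 * t ^+ 2 / 4)).
    by rewrite /amos_gap; lra.
  have [/andP[n0 n1] _] := nu0P.1.
  split=> //; first by lra.
  move=> t t0; apply: addr_ge0; last exact: sqr_ge0.
  move: a0; rewrite le_eqVlt => /predU1P[<-|a0].
    by apply: amos_gap_small; rewrite ?expr0n/=; lra.
  apply: (amos_gap_ge0_nu0 nu0P nu0nu).
  by rewrite divr_gt0// mulr_gt0// exprn_gt0.
have [F0 lcF] := log_concave_chi_cdf nu0 h.
split=> [x xJ|x y l xJ yJ l01].
  by move: (xJ); rewrite in_itv/= andbT => x0; rewrite marcumQ_chi_cdf// F0.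
have [x0 y0] : 0 <= x /\ 0 <= y by move: xJ yJ; rewrite !in_itv/= !andbT.
have /andP[l0 l1] := l01.
rewrite !marcumQ_chi_cdf//; first exact: lcF.
by rewrite addr_ge0// mulr_ge0 ?subr_ge0// ltW.
Qed.
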